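(* Let $r>1$ be real and for positive integers $\lambda_1,\lambda_2$ let $C_{\lambda_1,\lambda_2}(-1,1)=\sum_{j=0}^{\lambda_2}(-1)^j\binom{\lambda_1}{j}\binom{\lambda_2}{j}$. Let $N_r(x)=\#\{(\lambda_1,\lambda_2)\in\mathbb Z_{>0}^2:\ \lambda_1=r\lambda_2,\ C_{\lambda_1,\lambda_2}(-1,1)=0,\ \lambda_2\le x\}$. Then, as $x\to\infty$, $$N_r(x)\le\begin{cases}O_r(1)&\text{if } r>3+2\sqrt2,\\[2pt] \dfrac{102644}{(-r^2+6r-1)^{11/4}\log\left(\frac{1+\sqrt5}{2}\right)}\sqrt x\log x+O_r(\sqrt x)&\text{if } 1<r<3+2\sqrt2,\end{cases}$$ where the implied constants depend only on $r$. *)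

(* Defs.v *)
From mathcomp Require Import all_boot all_order all_algebra.
From mathcomp Require Import finmap.
From mathcomp Require Import all_classical all_reals all_analysis.

Set Implicit Arguments.
Unset Strict Implicit.
Unset Printing Implicit Defensive.

Import Order.TTheory GRing.Theory Num.Theory.

Local Open Scope classical_set_scope.
Local Open Scope ring_scope.

(* C_{l1, l2}(-1, 1) *)
Definition Cm11 (l1 l2 : nat) : int :=
  \sum_(j < l2.+1) (-1) ^+ j * 'C(l1, j)%:Z * 'C(l2, j)%:Z.

Definition zero_pairs (R : realType) (r x : R) : set (nat * nat) :=
  [set l | [/\ (0 < l.1)%N, (0 < l.2)%N, l.1%:R = r * l.2%:R,
               Cm11 l.1 l.2 = 0 & l.2%:R <= x]].

(* [fset_set A] is the finite set [A] when [A] is finite and is empty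
   otherwise; the lemma below shows that only the first case occurs here. *)
Definition Ncount (R : realType) (r x : R) : nat :=
  #|` fset_set (zero_pairs r x)|%fset.

Lemma finite_zero_pairs (R : realType) (r x : R) :
  finite_set (zero_pairs r x).
Proof.
pose M := Num.bound x; pose P := Num.bound (`|r| * M%:R).
apply: (@sub_finite_set _ _ (`I_P `*` `I_M)); last exact: finite_setX.
case=> l1 l2 [/= _ _ rl _ lx].
have x0 : 0 <= x by apply: le_trans lx.
have lM : l2%:R < M%:R :> R by exact: le_lt_trans lx (archi_boundP x0).
split=> /=; last by rewrite -(ltr_nat R).
rewrite -(ltr_nat R) rl; apply: le_lt_trans (ler_norm _) _.
rewrite normrM normr_nat.
apply: le_lt_trans (archi_boundP _); first by rewrite ler_wpM2l // ltW.
by rewrite mulr_ge0.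
Qed.

(* Main.v *)
(** C_{l1,l2}(-1,1) is the coefficient of z^l2 in (1-z)^l1 (1+z)^l2.

    If r > 3 + 2 sqrt 2, the coefficients p_k of this polynomial satisfy a
    three-term recurrence from which p_k / p_(k-1) stays negative up to k = l2,
    so C does not vanish once l2 is large.

    If r < 3 + 2 sqrt 2, then r = a/b in lowest terms (otherwise there is nothing
    to count), and f(m) = C_{am,bm} is the constant term of h^m, where
    h = (1-z)^a (1+z)^b / z^b.  The critical points of h are the two conjugate
    roots u, v of Q = a z^2 + (a-b) z + b.  Integration by parts,
    m CT(Q p h^m) = CT(D p h^m), reduces modulo Q at the cost of a factor 1/m.
    Taking a polynomial e that equals 1 to high order at u and 0 to high order
    at v, with e + conj e = 1, one gets f(m) = 2 Re Z_m for Z_m = CT(e h^m), and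
    three reductions give
      Z_(m+1) / Z_m = h(u) (1 - 1/(2m) + K/m^2 + O(1/m^3)),   Im K <> 0.
    Hence arg Z_m increases by theta + eps_m with eps_m = k/m^2 + O(1/m^3) and
    k <> 0.  If m1 < m2 < m3 < m4 are zeros of f, then eliminating theta from the
    angles swept over [m1,m2) and [m3,m4) shows that
    sum_{i in [m1,m2)} sum_{j in [m3,m4)} (eps_i - eps_j) is a multiple of pi.
    For zeros in a block [n^2,(n+1)^2), n large, this sum is less than pi in
    absolute value, and it is nonzero if m3 - m2 exceeds a constant.  So a block
    contains O(1) zeros, and N_r(x) = O(sqrt x), which is more than required. *)

Require Import Defs.
From mathcomp Require Import all_boot all_order all_algebra.
From mathcomp Require Import all_classical all_reals all_analysis.
From mathcomp Require Import finmap complex.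
From mathcomp Require Import ring lra zify.

Import Order.TTheory GRing.Theory Num.Theory.
Import numFieldNormedType.Exports.

Set Implicit Arguments.
Unset Strict Implicit.
Unset Printing Implicit Defensive.

Local Open Scope ring_scope.

(** * Constant terms of powers and integration by parts *)

Definition kernel_poly (R : comNzRingType) (a b : nat) : {poly R} :=
  (1 - 'X) ^+ a * (1 + 'X) ^+ b.

Definition saddle_poly (R : comNzRingType) (a b : nat) : {poly R} :=
  a%:R * 'X ^+ 2 + (a%:R - b%:R) * 'X + b%:R.

(** Since CT(z (z^-b (1-z^2) p h^m)') = 0 and (1-z^2) z h' = - Q h, the
    polynomials m Q p and [ibp b p] have the same [ray_coef]. *)
Definition ibp (R : comNzRingType) (b : nat) (p : {poly R}) : {poly R} :=
  'X * ((1 - 'X ^+ 2) * p)^`() - b%:R * ((1 - 'X ^+ 2) * p).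

(** The constant term of z^-b p h^m: the polynomial p stands for the Laurent
    polynomial z^-b p. *)
Definition ray_coef (R : comNzRingType) (a b m : nat) (p : {poly R}) : R :=
  (p * kernel_poly R a b ^+ m)`_(b * m.+1).

Lemma horner_natr (R : comNzRingType) n (x : R) : (n%:R : {poly R}).[x] = n%:R.
Proof. by rewrite -polyC_natr hornerC. Qed.

Lemma deriv_natr (R : comNzRingType) n : (n%:R : {poly R})^`() = 0.
Proof. by rewrite -polyC_natr derivC. Qed.

Lemma deriv1 (R : comNzRingType) : (1 : {poly R})^`() = 0.
Proof. by rewrite -polyC1 derivC. Qed.

Definition horner_simp := (horner_exp, hornerD, hornerN, horner_natr, hornerM, hornerC,
  hornerX, hornerXn).

Section Algebra.
Variable R : comNzRingType.
Implicit Types (p q : {poly R}) (a b m n : nat).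

Lemma deriv_expM (q : {poly R}) n : q * (q ^+ n)^`() = n%:R * q^`() * q ^+ n.
Proof.
rewrite deriv_exp; case: n => [|n]; first by rewrite mulr0n !mulr0 !mul0r.
by rewrite -mulr_natl /= exprS; ring.
Qed.

Lemma kernel_polyX a b m : kernel_poly R a b ^+ m = kernel_poly R (a * m) (b * m).
Proof. by rewrite /kernel_poly exprMn -!exprM. Qed.

(** P'/P = -a/(1-z) + b/(1+z), with the denominators cleared. *)
Lemma deriv_kernel_poly a b :
  (1 - 'X ^+ 2) * (kernel_poly R a b)^`()
  = ((b%:R - a%:R) - (a%:R + b%:R) * 'X) * kernel_poly R a b.
Proof.
rewrite /kernel_poly derivM.
have h1 := deriv_expM (1 - 'X) a; have h2 := deriv_expM (1 + 'X) b.
rewrite !poly.derivE ?sub0r ?add0r in h1 h2.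
set A := (_ ^+ a) in h1 *; set B := (_ ^+ b) in h2 *.
set A' := A^`() in h1 *; set B' := B^`() in h2 *.
transitivity ((1 + 'X) * B * ((1 - 'X) * A') + (1 - 'X) * A * ((1 + 'X) * B')).
  by ring.
rewrite h1 h2; ring.
Qed.

Lemma coefX_deriv p n : ('X * p^`())`_n = p`_n *+ n.
Proof. by rewrite coefXM coef_deriv; case: n => [|n] //=; rewrite mulr0n. Qed.

Lemma ray_coef_ibp a b m p :
  m%:R * ray_coef a b m (saddle_poly R a b * p) = ray_coef a b m (ibp b p).
Proof.
rewrite /ray_coef kernel_polyX; set P := kernel_poly R _ _.
have hP : (1 - 'X ^+ 2) * P^`()
  = m%:R * ((b%:R - a%:R) - (a%:R + b%:R) * 'X) * P.
  by rewrite deriv_kernel_poly -/P !natrM; ring.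
clearbody P; set N := (b * m.+1)%N; set W := (1 - 'X ^+ 2) * p.
(* The difference of the two sides has the form z S' - N S, whose coefficient of z^N is zero. *)
have key : ibp b p * P - m%:R * (saddle_poly R a b * p * P)
    = 'X * (W * P)^`() - N%:R * (W * P).
  transitivity (ibp b p * P + (p * 'X) * ((1 - 'X ^+ 2) * P^`())
    - (b * m)%:R * (W * P)).
    by rewrite hP /saddle_poly /W natrM; ring.
  rewrite derivM /ibp -/W /N mulnS natrD natrM; move: (W^`()) (P^`()) => W' P'.
  by rewrite /W; ring.
have := congr1 (fun q : {poly R} => q`_N) key.
rewrite !coefB coefX_deriv !(mulr_natl, coefMn) subrr => /eqP.
by rewrite subr_eq0 => /eqP ->.
Qed.

Lemma ray_coefD a b m p q :
  ray_coef a b m (p + q) = ray_coef a b m p + ray_coef a b m q.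
Proof. by rewrite /ray_coef mulrDl coefD. Qed.

Lemma ray_coefCM a b m c p : ray_coef a b m (c%:P * p) = c * ray_coef a b m p.
Proof. by rewrite /ray_coef -mulrA coefCM. Qed.

Lemma ray_coef_sum a b m (I : Type) (s : seq I) (F : I -> {poly R}) :
  ray_coef a b m (\sum_(i <- s) F i) = \sum_(i <- s) ray_coef a b m (F i).
Proof. by rewrite /ray_coef mulr_suml coef_sum. Qed.

(** One factor of h^(m+1) is absorbed into the polynomial: ['X^b] cancels the built-in z^-b, and
    [kernel_poly] = z^b h brings it back. *)
Lemma ray_coefS a b m p :
  ray_coef a b m.+1 ('X^b * p) = ray_coef a b m (p * kernel_poly R a b).
Proof.
rewrite /ray_coef -mulrA coefXnM mulnS ltnNge leq_addr /= addKn.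
by rewrite exprS mulrA.
Qed.

Lemma ibp_vanish b n (v : R) (s : {poly R}) :
  exists s', ibp b (('X - v%:P) ^+ n.+1 * s) = ('X - v%:P) ^+ n * s'.
Proof.
exists ('X * (n.+1%:R * ((1 - 'X ^+ 2) * s) + ('X - v%:P) * ((1 - 'X ^+ 2) * s)^`())
        - b%:R * ((1 - 'X ^+ 2) * ('X - v%:P) * s)).
rewrite /ibp mulrCA derivM deriv_exp derivXsubC mul1r -mulr_natl /=.
by move: (_^`()) => d; rewrite [_ ^+ n.+1]exprS; ring.
Qed.
End Algebra.

Section Saddle.
Variables (F : numFieldType) (a b : nat) (u v : F).
Hypothesis a_gt0 : (0 < a)%N.
Hypothesis saddleE : saddle_poly F a b = a%:R * (('X - u%:P) * ('X - v%:P)).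
Hypothesis neq_uv : u != v.
Hypothesis u_neq0 : u != 0.

Let a_neq0 : a%:R != 0 :> F. Proof. by rewrite pnatr_eq0 -lt0n. Qed.

(** Each reduction modulo Q lowers by 2 the order of vanishing at v, so that the
    critical point v never contributes. *)
Lemma saddle_step n (e e' p s : {poly F}) :
    e = ('X - v%:P) ^+ n.+2 * e' -> e.[u] = 1 -> p = ('X - v%:P) ^+ n.+2 * s ->
  exists q, p = (p.[u] / u ^+ b)%:P * ('X^b * e) + saddle_poly F a b * q
    /\ exists s', ibp b q = ('X - v%:P) ^+ n * s'.
Proof.
move=> eE eu pE.
(* Since e(u) = 1, this multiple of e makes the cofactor t vanish at u. The factor X - u of t and
   one of the factors X - v make up Q; [ibp] costs another X - v. *)
pose t := s - (p.[u] / u ^+ b)%:P * ('X^b * e').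
have tu : root t u.
  have uv0 : (u - v) ^+ n.+2 != 0 by rewrite expf_neq0 // subr_eq0.
  rewrite /root -(mulrI_eq0 _ (lregP uv0)) mulrC /t.
  have -> : (s - (p.[u] / u ^+ b)%:P * ('X^b * e')).[u] * (u - v) ^+ n.+2
      = (p - (p.[u] / u ^+ b)%:P * ('X^b * e)).[u].
    by rewrite {2}pE eE !horner_simp; ring.
  by rewrite !horner_simp eu; apply/eqP; field; rewrite expf_neq0.
have [t' tE] := factor_theorem _ _ tu.
exists ((a%:R^-1)%:P * (('X - v%:P) ^+ n.+1 * t')); split; last first.
  have [s' s'E] := ibp_vanish b n v ((a%:R^-1)%:P * t').
  by exists s'; rewrite -s'E mulrCA.
have aP : a%:R * (a%:R^-1)%:P = 1 :> {poly F} by rewrite -polyC_natr -polyCM divff.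
transitivity ((p.[u] / u ^+ b)%:P * ('X^b * e) + ('X - v%:P) ^+ n.+2 * t).
  by rewrite /t {1}pE eE; ring.
rewrite saddleE tE; congr (_ + _).
transitivity ((a%:R * (a%:R^-1)%:P)
  * (('X - v%:P) ^+ n.+2 * (t' * ('X - u%:P)))); first by rewrite aP mul1r.
by rewrite exprS; ring.
Qed.
End Saddle.

(** 3/8 - (G4 / (8 G2^2) - 5 G3^2 / (24 G2^3)), where Gi is the value at the
    critical point u of (z d/dz)^i log h: here 3/8 comes from the factor m^(-1/2)
    and the rest from the second term of Laplace's expansion.  The integer b has
    been eliminated by b = - a u (1+u) / (1-u). *)
Definition second_coef (F : fieldType) (a : nat) (u : F) : F :=
  3 / 8 - (1 + 5 * u + 4 * u ^+ 2 - 43 * u ^+ 3 + 6 * u ^+ 4 + 43 * u ^+ 5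
           + 4 * u ^+ 6 - 5 * u ^+ 7 + u ^+ 8)
          / (12 * a%:R * u * (1 + u) * (1 + 2 * u - u ^+ 2) ^+ 3).

(** * The two-term expansion at a critical point *)

Section Jets.
Variables (F : numFieldType) (a b : nat) (u : F).
Hypothesis a_neq0 : a%:R != 0 :> F.
Hypothesis u_neq0 : u != 0.
Hypothesis u_neq1 : 1 - u != 0.
Hypothesis u_neqN1 : 1 + u != 0.
Hypothesis T_neq0 : 1 + 2 * u - u ^+ 2 != 0.
Hypothesis bE : b%:R = - (a%:R * u * (1 + u) / (1 - u)) :> F.

(** Lets an unknown remainder of order 6 at u be differentiated repeatedly and then dropped on
    evaluation at u. *)
Lemma flat_deriv n (s : {poly F}) :
  exists s', (('X - u%:P) ^+ n.+1 * s)^`() = ('X - u%:P) ^+ n * s'.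
Proof.
exists (n.+1%:R * s + ('X - u%:P) * s^`()).
rewrite derivM deriv_exp derivXsubC mul1r -mulr_natl /=.
by rewrite [_ ^+ n.+1]exprS; move: (s^`()) => d; ring.
Qed.

(** These are the coefficients of 1/m and 1/m^2. Since e - 1 vanishes to order 6 at u, four
    derivatives of the first identity and two of the second do not see e at u; they fix q1 to third
    order and q2 to first order there, which is all that is needed. *)
Lemma saddle_jets (e e2 q1 q2 : {poly F}) (k : F) :
    e = 1 - ('X - u%:P) ^+ 6 * e2 ->
    e * kernel_poly F a b = ((kernel_poly F a b).[u] / u ^+ b)%:P * ('X^b * e)
      + saddle_poly F a b * q1 ->
    ibp b q1 = k%:P * ('X^b * e) + saddle_poly F a b * q2 ->
  let w := (kernel_poly F a b).[u] / u ^+ b in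
  k = - w / 2 /\ (ibp b q2).[u] / u ^+ b = w * second_coef a u.
Proof.
move=> eE h1 h2 w.
set A := kernel_poly F a b in h1 w *.
have U0 : u ^+ b != 0 by rewrite expf_neq0.
have EA : (1 - 'X ^+ 2) * A^`() = ((b%:R - a%:R) - (a%:R + b%:R) * 'X) * A.
  exact: deriv_kernel_poly.
have EB : 'X * ('X^b)^`() = b%:R * 'X^b :> {poly F}.
  by rewrite deriv_expM derivX mulr1.
have EAu : A.[u] = w * u ^+ b by rewrite /w; field.
have EBu : 'X^b.[u] = u ^+ b by rewrite hornerXn.
move: h1; rewrite -/w => h1.
move: ('X^b) EB EBu h1 h2 => B EB EBu h1 h2.
move: (u ^+ b) U0 EAu EBu => U U0 EAu EBu.
clearbody w A.
have {}h1 : saddle_poly F a b * q1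
    = A - w%:P * B + ('X - u%:P) ^+ 6 * (- e2 * (A - w%:P * B)).
  apply/eqP; rewrite -subr_eq0; move/eqP: h1; rewrite -subr_eq0 => /eqP h1.
  by rewrite -oppr_eq0; apply/eqP; rewrite -[RHS]h1 eE; ring.
have {}h2 : saddle_poly F a b * q2
    = ibp b q1 - k%:P * B + ('X - u%:P) ^+ 6 * (k%:P * B * e2).
  by rewrite h2 eE; ring.
move: (- e2 * _) h1 => s1 h1.
move: (k%:P * B * e2) h2 => s2 h2.
rewrite /ibp /saddle_poly in h1 h2 *; rewrite !expr2 in EA h1 h2 *.
have [f1 F1] := flat_deriv 5 s1; have [f2 F2] := flat_deriv 4 f1.
have [f3 F3] := flat_deriv 3 f2; have [f4 F4] := flat_deriv 2 f3.
have [g1 G1] := flat_deriv 5 s2; have [g2 G2] := flat_deriv 4 g1.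
pose dE := (F1, F2, F3, F4, G1, G2, derivD, derivN, derivM, deriv_natr,
  derivX, derivC, deriv1, deriv0, mul0r, mulr0, add0r, addr0, mul1r, mulr1, oppr0).
have EA1 := congr1 deriv EA; rewrite !dE in EA1.
have EA2 := congr1 deriv EA1; rewrite !dE in EA2.
have EA3 := congr1 deriv EA2; rewrite !dE in EA3.
have EB1 := congr1 deriv EB; rewrite !dE in EB1.
have EB2 := congr1 deriv EB1; rewrite !dE in EB2.
have EB3 := congr1 deriv EB2; rewrite !dE in EB3.
have H1 := congr1 deriv h1; rewrite !dE in H1.
have H2 := congr1 deriv H1; rewrite !dE in H2.
have H3 := congr1 deriv H2; rewrite !dE in H3.
have H4 := congr1 deriv H3; rewrite !dE in H4.
rewrite !dE in h2 *.
have K1 := congr1 deriv h2; rewrite !dE in K1.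
have K2 := congr1 deriv K1; rewrite !dE in K2.
have ev p q : p = q -> p.[u] = q.[u] by move->.
have zero i (x : F) : (u - u) ^+ i.+1 * x = 0 by rewrite subrr exprS !mul0r.
have a0 := ev _ _ EA; rewrite !horner_simp EAu in a0.
have a1 := ev _ _ EA1; rewrite !horner_simp EAu in a1.
have a2 := ev _ _ EA2; rewrite !horner_simp in a2.
have a3 := ev _ _ EA3; rewrite !horner_simp in a3.
have b0 := ev _ _ EB; rewrite !horner_simp EBu in b0.
have b1 := ev _ _ EB1; rewrite !horner_simp in b1.
have b2 := ev _ _ EB2; rewrite !horner_simp in b2.
have b3 := ev _ _ EB3; rewrite !horner_simp in b3.
have {}H1 := ev _ _ H1; rewrite !(horner_simp, zero, addr0) in H1.
have {}H2 := ev _ _ H2; rewrite !(horner_simp, zero, addr0) in H2.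
have {}H3 := ev _ _ H3; rewrite !(horner_simp, zero, addr0) in H3.
have {}H4 := ev _ _ H4; rewrite !(horner_simp, zero, addr0) in H4.
have {}K1 := ev _ _ K1; rewrite !(horner_simp, zero, addr0) in K1.
have {}K2 := ev _ _ K2; rewrite !(horner_simp, zero, addr0) in K2.
have h0 := ev _ _ h2; rewrite !(horner_simp, zero, addr0) EBu in h0.
rewrite !horner_simp.
move: a0 a1 a2 a3 b0 b1 b2 b3 H1 H2 H3 H4 h0 K1 K2.
clear -a_neq0 u_neq0 u_neq1 u_neqN1 T_neq0 bE U0.
move: A^`()^`()^`()^`().[u] A^`()^`()^`().[u] A^`()^`().[u] A^`().[u] => A4 A3 A2 A1.
move: B^`()^`()^`()^`().[u] B^`()^`()^`().[u] B^`()^`().[u] B^`().[u] => B4 B3 B2 B1.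
move: q1^`()^`()^`()^`().[u] q1^`()^`()^`().[u] q1^`()^`().[u] q1^`().[u] q1.[u]
  => q14 q13 q12 q11 q10.
move: q2^`()^`().[u] q2^`().[u] q2.[u] => q22 q21 q20.
(* The A_i, B_i, q1_i, q2_i are the derivatives at u; they are determined one
   after the other by triangular linear equations. *)
rewrite /second_coef => a0 a1 a2 a3 b0 b1 b2 b3 h1 h2 h3 h4 h0 k1 k2.
pose d := 1 + 2 * u - u ^+ 2; pose be := b%:R / u.
(* [be] is the common value at u of the logarithmic derivatives of the kernel and of ['X^b]; [l1],
   [l2], [l3] are the first three derivatives of that of the kernel. *)
pose l1 := - a%:R / (1 - u) ^+ 2 - b%:R / (1 + u) ^+ 2.
pose l2 := - 2 * a%:R / (1 - u) ^+ 3 + 2 * b%:R / (1 + u) ^+ 3.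
pose l3 := - 6 * a%:R / (1 - u) ^+ 4 - 6 * b%:R / (1 + u) ^+ 4.
have uu : 1 - u * u != 0.
  by rewrite (_ : 1 - u * u = (1 - u) * (1 + u)) ?mulf_neq0 //; ring.
have Qu : a%:R * (u * u) + (a%:R - b%:R) * u + b%:R = 0 by rewrite bE; field.
have Q1u : a%:R * (u + u) + (a%:R - b%:R) = a%:R * d / (1 - u) by rewrite bE /d; field.
have nz : a%:R * d / (1 - u) != 0 by rewrite mulf_neq0 ?invr_eq0 // mulf_neq0.
have nz2 : 2 * (a%:R * d / (1 - u)) != 0 by rewrite mulf_neq0 // pnatr_eq0.
have nz3 : 3 * (a%:R * d / (1 - u)) != 0 by rewrite mulf_neq0 // pnatr_eq0.
have nz4 : 4 * (a%:R * d / (1 - u)) != 0 by rewrite mulf_neq0 // pnatr_eq0.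
rewrite Qu Q1u in h1 h2 h3 h4 h0 k1 k2 *.
have A1E : A1 = w * U * be.
  by apply: (mulfI uu); rewrite a0 /be bE; field; apply/andP.
have A2E : A2 = w * U * (be ^+ 2 + l1).
  apply: (mulfI uu); apply: (addrI (- (u + u) * A1)); rewrite a1 A1E /be /l1 bE.
  by field; apply/and3P.
have A3E : A3 = w * U * (be ^+ 3 + 3 * be * l1 + l2).
  apply: (mulfI uu); apply: (addrI (- (u + u) * A2)).
  apply: (addrI (- (1 + 1) * A1 + - (u + u) * A2)); rewrite a2 A2E A1E /be /l1 /l2 bE.
  by field; apply/and3P.
have B1E : B1 = U * be by apply: (mulfI u_neq0); rewrite b0 /be; field.
have B2E : B2 = U * (be ^+ 2 - b%:R / u ^+ 2).
  apply: (mulfI u_neq0); apply: (addrI B1); rewrite b1 B1E /be.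
  by field.
have B3E : B3 = U * (be ^+ 3 - 3 * be * b%:R / u ^+ 2 + 2 * b%:R / u ^+ 3).
  apply: (mulfI u_neq0); apply: (addrI B2); apply: (addrI B2).
  by rewrite b2 B2E /be; field.
have B4E : B4 = U * (be ^+ 4 - 6 * be ^+ 2 * b%:R / u ^+ 2
    + 3 * (b%:R / u ^+ 2) ^+ 2 + 8 * be * b%:R / u ^+ 3 - 6 * b%:R / u ^+ 4).
  apply: (mulfI u_neq0); do 3 apply: (addrI B3).
  by rewrite b3 B3E /be; field.
have A4E : A4 = w * U * (be ^+ 4 + 6 * be ^+ 2 * l1 + 3 * l1 ^+ 2 + 4 * be * l2 + l3).
  apply: (mulfI uu); apply: (addrI (- (u + u) * A3)).
  apply: (addrI (- (1 + 1) * A2 + - (u + u) * A3)).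
  apply: (addrI (- (1 + 1) * A2 + (- (1 + 1) * A2 + - (u + u) * A3))).
  rewrite a3 A3E A2E /be /l1 /l2 /l3 bE.
  by field; apply/and3P.
(* u is a critical point of h, so [A1] = w [B1]. *)
have q10E : q10 = 0.
  apply: (mulfI nz); rewrite mulr0; move: h1; rewrite mul0r addr0 => ->.
  by rewrite A1E B1E; ring.
rewrite q10E !(mulr0, mul0r, addr0, add0r, subr0) in h2 h3 h4 h0 k1 k2 *.
have q11E : q11 = - (w * U / (2 * u * (1 - u) * (1 + u))).
  apply: (mulfI nz2).
  transitivity (A2 - w * B2); first by rewrite -h2; ring.
  by rewrite A2E B2E /be /l1 /d bE; field; rewrite ?u_neq0 ?u_neq1 ?u_neqN1.
have q12E : q12 = (A3 - w * B3 - 6 * a%:R * q11) / (3 * (a%:R * d / (1 - u))).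
  by rewrite -h3; field; rewrite ?u_neq1 ?a_neq0 ?T_neq0.
have q13E : q13 = (A4 - w * B4 - 12 * a%:R * q12) / (4 * (a%:R * d / (1 - u))).
  by rewrite -h4; field; rewrite ?u_neq1 ?a_neq0 ?T_neq0.
have kE : k = - w / 2.
  apply: (mulIf U0); move/eqP: h0; rewrite eq_sym subr_eq0 => /eqP <-.
  by rewrite q11E; field; rewrite ?u_neq0 ?u_neq1 ?u_neqN1.
split => //.
have q20E := canRL (mulKf nz) k1.
pose g := (1 - u * u) * q12 - 4 * u * q11.
have q21E : q21 = (2 * g + u * ((1 - u * u) * q13 - 6 * u * q12 - 6 * q11)
    - b%:R * g - k * B2 - 2 * a%:R * q20) / (2 * (a%:R * d / (1 - u))).
  transitivity ((a%:R * (1 + 1) * q20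
    + (a%:R * d / (1 - u) * q21 + a%:R * d / (1 - u) * q21)
    - 2 * a%:R * q20) / (2 * (a%:R * d / (1 - u)))).
    by field; rewrite ?u_neq1 ?a_neq0 ?T_neq0.
  by congr (_ / _); rewrite addrA k2 /g; ring.

rewrite q21E q20E q13E q12E A4E A3E B4E B3E B2E B1E kE /g q12E A3E B3E q11E
  /be /l1 /l2 /l3 /d bE.
field.
by rewrite ?u_neq0 ?u_neq1 ?u_neqN1 ?a_neq0 ?T_neq0 ?U0.
Qed.
End Jets.

(** The upper half of the binomial expansion of (x + y)^11. *)
Definition blend (F : comNzRingType) (x y : F) : F :=
  x ^+ 6 * (462%:R * y ^+ 5 + 330%:R * x * y ^+ 4 + 165%:R * x ^+ 2 * y ^+ 3
            + 55%:R * x ^+ 3 * y ^+ 2 + 11%:R * x ^+ 4 * y + x ^+ 5).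

Lemma blend_sum (F : comNzRingType) (x y : F) : blend x y + blend y x = (x + y) ^+ 11.
Proof. by rewrite /blend; ring. Qed.

(** Equal to 1 to order 6 at u, and to 0 to order 6 at v. *)
Definition cutoff (F : fieldType) (u v : F) : {poly F} :=
  blend (((u - v)^-1)%:P * ('X - v%:P)) (((v - u)^-1)%:P * ('X - u%:P)).

Section Expansion.
Variables (F : numFieldType) (a b : nat) (u v : F).
Hypothesis a_gt0 : (0 < a)%N.
Hypothesis b_gt0 : (0 < b)%N.
Hypothesis neq_uv : u != v.
Hypothesis saddleE : saddle_poly F a b = a%:R * (('X - u%:P) * ('X - v%:P)).

(** The arguments of [blend] are the interpolation polynomials of degree 1 at u and v, and these add
    up to 1. *)
Lemma cutoffD : cutoff u v + cutoff v u = 1.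
Proof.
rewrite /cutoff blend_sum.
suff -> : ((u - v)^-1)%:P * ('X - v%:P) + ((v - u)^-1)%:P * ('X - u%:P) = 1.
  by rewrite expr1n.
have -> : (v - u)^-1 = - (u - v)^-1 by rewrite -invrN opprB.
transitivity (((u - v)^-1)%:P * (u - v)%:P : {poly F}).
  by rewrite polyCN polyCB; ring.
by rewrite -polyCM mulVf // subr_eq0.
Qed.

Lemma cutoff_factor (x y : F) : exists e, cutoff x y = ('X - y%:P) ^+ 6 * e.
Proof.
rewrite /cutoff /blend exprMn; set c := _ ^+ 6; set p := (_ + _ ^+ 5).
by exists (c * p); ring.
Qed.

Let a_neq0 : a%:R != 0 :> F. Proof. by rewrite pnatr_eq0 -lt0n. Qed.
Let b_neq0 : b%:R != 0 :> F. Proof. by rewrite pnatr_eq0 -lt0n. Qed.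

(** This lemma and the next two get the symmetric relations of the roots by evaluating the
    factorisation at 1, -1 and 0; they also keep u away from these points. *)
Lemma saddle_at1 : (1 - u) * (1 - v) = 2.
Proof.
have := congr1 (horner^~ 1) saddleE; rewrite /saddle_poly !horner_simp => h.
by apply: (mulfI a_neq0); rewrite -h; ring.
Qed.

Lemma saddle_atN1 : (1 + u) * (1 + v) = 2 * (b%:R / a%:R).
Proof.
have := congr1 (horner^~ (-1)) saddleE; rewrite /saddle_poly !horner_simp => h.
apply: (mulfI a_neq0); transitivity (2 * b%:R : F); last by field.
by transitivity (a%:R * ((-1 - u) * (-1 - v))); [|rewrite -h]; ring.
Qed.

Lemma saddle_at0 : u * v = b%:R / a%:R.
Proof.
have := congr1 (horner^~ 0) saddleE; rewrite /saddle_poly !horner_simp => h.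
apply: (mulfI a_neq0); transitivity (b%:R : F); last by field.
by transitivity (a%:R * ((0 - u) * (0 - v))); [|rewrite -h]; ring.
Qed.

Lemma saddle_neq0 : u != 0.
Proof.
apply/eqP => u0; move: saddle_at0; rewrite u0 mul0r => /esym/eqP.
by rewrite mulf_eq0 invr_eq0 (negbTE a_neq0) (negbTE b_neq0).
Qed.

Lemma saddle_neq1 : 1 - u != 0.
Proof.
apply/eqP => u0; move: saddle_at1; rewrite u0 mul0r => /esym/eqP.
by rewrite pnatr_eq0.
Qed.

Lemma saddle_neqN1 : 1 + u != 0.
Proof.
apply/eqP => u0; move: saddle_atN1; rewrite u0 mul0r => /esym/eqP.
by rewrite !mulf_eq0 invr_eq0 (negbTE a_neq0) (negbTE b_neq0) pnatr_eq0.
Qed.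

(** A Moebius function of u: with [saddle_bE] it turns the identities below into identities of
    rational functions of u and a. *)
Lemma saddle_conjE : v = - ((1 + u) / (1 - u)).
Proof.
have h := saddle_at1; apply: (mulfI saddle_neq1).
transitivity (1 - u - (1 - u) * (1 - v)); first by ring.
by rewrite h; field; exact: saddle_neq1.
Qed.

Lemma saddle_bE : b%:R = - (a%:R * u * (1 + u) / (1 - u)) :> F.
Proof.
transitivity (a%:R * (u * v)); first by rewrite saddle_at0; field.
by rewrite saddle_conjE; field; exact: saddle_neq1.
Qed.

Lemma saddle_disc : 1 + 2 * u - u ^+ 2 = (1 - u) * (u - v).
Proof. by rewrite saddle_conjE; field; exact: saddle_neq1. Qed.

(** For conjugate u and v the left side is 2i Im K, and the right side is visibly nonzero when a <>
    b. *)
Lemma second_coef_sub : second_coef a u - second_coef a v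
  = (a%:R - b%:R) ^+ 2 * (a%:R ^+ 2 - a%:R * b%:R + b%:R ^+ 2)
    / (6 * b%:R * a%:R ^+ 4 * (u - v) ^+ 3).
Proof.
have T0 : 1 + 2 * u - u ^+ 2 != 0.
  by rewrite saddle_disc mulf_neq0 ?saddle_neq1 ?subr_eq0.
rewrite /second_coef saddle_bE saddle_conjE.
field.
rewrite !(saddle_neq1, saddle_neqN1, saddle_neq0, a_neq0) /=.
rewrite (_ : u * (1 - u) - - (1 + u) = 1 + 2 * u - u ^+ 2); last by ring.
rewrite (_ : (1 - u + 2 * - (1 + u)) * (1 - u) - (- (1 + u)) ^+ 2
  = - 2 * (1 + 2 * u - u ^+ 2)); last by ring.
rewrite (_ : 1 - u - (1 + u) = - 2 * u); last by ring.
by rewrite T0 !mulf_eq0 !oppr_eq0 !pnatr_eq0 (negbTE T0) (negbTE saddle_neq0).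
Qed.

(** Three reductions, each using up 2 of the order 6 at v: the first gives the constant term, the
    others those in 1/m and 1/m^2, and what is left carries 1/m^3. *)
Lemma saddle_expansion : exists s : {poly F}, forall m, (0 < m)%N ->
  ray_coef a b m.+1 ('X^b * cutoff u v) =
    (kernel_poly F a b).[u] / u ^+ b *
      (1 - (2 * m%:R)^-1 + second_coef a u / m%:R ^+ 2)
      * ray_coef a b m ('X^b * cutoff u v)
    + ray_coef a b m s / m%:R ^+ 3.
Proof.
set e := cutoff u v; set P := kernel_poly F a b; set w := P.[u] / u ^+ b.
have [e' eE] : exists e', e = ('X - v%:P) ^+ 6 * e' by exact: cutoff_factor.
have [e2 e2E] := cutoff_factor v u.
have eE2 : e = 1 - ('X - u%:P) ^+ 6 * e2.
  by apply/eqP; rewrite eq_sym subr_eq -e2E; apply/eqP; rewrite cutoffD.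
have eu : e.[u] = 1 by rewrite eE2 !horner_simp subrr expr0n /= mul0r subr0.
have fac n k : (n <= 6)%N -> k = (6 - n)%N ->
    e = ('X - v%:P) ^+ n * (('X - v%:P) ^+ k * e').
  by move=> n6 ->; rewrite mulrA -exprD subnKC.
have step := saddle_step a_gt0 saddleE neq_uv saddle_neq0.
have eP : e * P = ('X - v%:P) ^+ 6 * (e' * P) by rewrite eE mulrA.
have [q1 [q1E [s1 s1E]]] := step 4 e _ (e * P) _ (fac 6 0%N isT erefl) eu eP.
have [q2 [q2E [s2 s2E]]] := step 2 e _ _ _ (fac 4 2%N isT erefl) eu s1E.
have [q3 [q3E [s3 s3E]]] := step 0%N e _ _ _ (fac 2 4%N isT erefl) eu s2E.
have ePu : (e * P).[u] = P.[u] by rewrite hornerM eu mul1r.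
rewrite ePu in q1E.
have T0 : 1 + 2 * u - u ^+ 2 != 0.
  by rewrite saddle_disc mulf_neq0 ?saddle_neq1 ?subr_eq0.
have [k1E k2E] := saddle_jets a_neq0 saddle_neq0 saddle_neq1 saddle_neqN1 T0 saddle_bE
  eE2 q1E q2E.
exists (ibp b q3) => m m_gt0; rewrite ray_coefS -/P -/w.
have m0 : m%:R != 0 :> F by rewrite pnatr_eq0 -lt0n.
have ray_ibp q :
    ray_coef a b m (saddle_poly F a b * q) = ray_coef a b m (ibp b q) / m%:R.
  by rewrite -ray_coef_ibp [_ / _]mulrC mulKf.
rewrite q1E ray_coefD ray_coefCM ray_ibp q2E ray_coefD ray_coefCM ray_ibp.
rewrite q3E ray_coefD ray_coefCM ray_ibp.
move: (ray_coef a b m ('X^b * e)) => Z.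
by rewrite k1E k2E -/w; field.
Qed.
End Expansion.

(** * Three-term recurrence for the coefficients of the kernel *)

Section Recurrence.
Variables (R : comNzRingType) (a b : nat).

Lemma kernel_poly_coef0 : (kernel_poly R a b)`_0 = 1.
Proof. by rewrite -horner_coef0 /kernel_poly !horner_simp subr0 addr0 !expr1n mulr1. Qed.

Lemma kernel_poly_coef1 : (kernel_poly R a b)`_1 = b%:R - a%:R.
Proof.
have := congr1 (fun p : {poly R} => p`_0) (deriv_kernel_poly R a b).
rewrite mulrBl mul1r coefB coefXnM /= subr0 coef_deriv mulr1n => ->.
rewrite mulrBl -mulrA [X in _ - X]mulrCA coefB coefXM /= subr0.
by rewrite -!polyC_natr -polyCB coefCM kernel_poly_coef0 mulr1.
Qed.

Lemma kernel_poly_rec k (p := kernel_poly R a b) :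
  p`_k.+2 * k.+2%:R - p`_k * k%:R
  = (b%:R - a%:R) * p`_k.+1 - (a%:R + b%:R) * p`_k.
Proof.
have := congr1 (fun p : {poly R} => p`_k.+1) (deriv_kernel_poly R a b).
rewrite -/p mulrBl mul1r coefB coefXnM coef_deriv => h.
have -> : p`_k * k%:R = (if (k.+1 < 2)%N then 0 else p^`()`_(k.+1 - 2)).
  by case: (k) => [|j]; rewrite ?(mulr0n, mulr0) //= subn2 /= coef_deriv mulr_natr.
rewrite mulr_natr h mulrBl -mulrA coefB -!polyC_natr -polyCB -polyCD !coefCM.
by rewrite coefXM.
Qed.
End Recurrence.

(** Read downwards, the recurrence has p_n multiplied by a + b - n, which is nonzero in this range,
    so two neighbouring zeros would spread down to p_0 = 1. *)
Lemma kernel_poly_consecutive (R : numDomainType) a b n (p := kernel_poly R a b) :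
  (n < a + b)%N -> p`_n = 0 -> p`_n.+1 = 0 -> False.
Proof.
elim: n => [|n IHn] ltn p0 p1.
  by move: p0; rewrite kernel_poly_coef0 => /eqP; rewrite oner_eq0.
apply: IHn => //; first exact: ltnW.
have /= := kernel_poly_rec R a b n; rewrite -/p p0 p1 mul0r mulr0 !sub0r => /eqP.
rewrite eqr_opp [_ * p`_n]mulrC -subr_eq0 -mulrBr mulf_eq0 => /orP[/eqP//|].
by rewrite -natrD subr_eq0 eqr_nat; lia.
Qed.

(** * A real-valued norm on the complex numbers *)

Section Norm1.
Variable R : realType.
Implicit Types x y z : R[i].

(** Submultiplicative, like the modulus, but real-valued and free of square roots. *)
Definition norm1 z : R := `|complex.Re z| + `|complex.Im z|.

Lemma norm1_ge0 z : 0 <= norm1 z. Proof. exact: addr_ge0. Qed.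

Lemma norm1D x y : norm1 (x + y) <= norm1 x + norm1 y.
Proof.
case: x y => [x1 x2] [y1 y2]; rewrite /norm1 /=.
by have := ler_normD x1 y1; have := ler_normD x2 y2; lra.
Qed.

Lemma norm1M x y : norm1 (x * y) <= norm1 x * norm1 y.
Proof.
case: x y => [x1 x2] [y1 y2]; rewrite /norm1 /=.
have := ler_normB (x1 * y1) (x2 * y2); have := ler_normD (x1 * y2) (x2 * y1).
by rewrite !normrM; lra.
Qed.

Lemma norm1_eq0 z : (norm1 z == 0) = (z == 0).
Proof. by case: z => x y; rewrite /norm1 paddr_eq0 // !normr_eq0 eq_complex. Qed.

Lemma norm1_real (x : R) z : norm1 (x%:C%C * z) = `|x| * norm1 z.
Proof. by case: z => y z; rewrite /norm1 /= !mul0r subr0 addr0 !normrM mulrDr. Qed.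

Lemma norm1_sum (I : Type) (s : seq I) (F : I -> R[i]) :
  norm1 (\sum_(i <- s) F i) <= \sum_(i <- s) norm1 (F i).
Proof.
elim/big_ind2 : _ => [|x x' y y' hx hy|//]; first by rewrite /norm1 normr0 addr0.
exact: le_trans (norm1D _ _) (lerD hx hy).
Qed.

Lemma norm1_conj z : norm1 z^*%C = norm1 z.
Proof. by case: z => x y; rewrite /norm1 /= normrN. Qed.
End Norm1.

Lemma size_X_deriv (R : comNzRingType) (p : {poly R}) (n : nat) :
  (size p <= n)%N -> (size ('X * p^`())%R <= n)%N.
Proof.
move=> pn; apply/leq_sizeP => j nj.
by rewrite coefX_deriv nth_default ?mul0rn // (leq_trans pn).
Qed.

(** [ibp] raises the degree by at most 2, which is what division by Q takes away; reduction
    therefore stays inside a fixed finite-dimensional space. *)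
Lemma size_ibp (R : idomainType) b (p : {poly R}) (n : nat) :
  (size p + 2 <= n)%N -> (size (ibp b p) <= n)%N.
Proof.
move=> pn; have h : (size ((1 - 'X ^+ 2) * p)%R <= n)%N.
  apply: leq_trans (size_polyMleq _ _) _.
  have : (size (1 - 'X ^+ 2 : {poly R})%R <= 3)%N.
    by rewrite (leq_trans (size_polyD _ _)) // size_polyN size_polyXn size_poly1.
  move=> h3; rewrite -subn1 leq_subLR; apply: leq_trans (leq_add h3 (leqnn _)) _.
  by move: (size p) pn => k; lia.
rewrite /ibp (leq_trans (size_polyD _ _)) // geq_max size_X_deriv //= size_polyN.
by rewrite mulr_natl -scaler_nat (leq_trans (size_scale_leq _ _)).
Qed.

Lemma rmorph_blend (F G : comNzRingType) (f : {rmorphism F -> G}) x y :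
  f (blend x y) = blend (f x) (f y).
Proof. by rewrite /blend; ring. Qed.

(** * Bounding all coefficient functionals by the saddle part *)

Section Contraction.
Variables (R : realType) (a b : nat) (u : R[i]).
Hypothesis a_gt0 : (0 < a)%N.
Hypothesis b_gt0 : (0 < b)%N.
Local Notation v := (u^*%C).
Hypothesis neq_uv : u != v.
Hypothesis saddleE : saddle_poly R[i] a b = a%:R * (('X - u%:P) * ('X - v%:P)).

(** Z_m of the overview; ['X^b] cancels the z^-b built into [ray_coef]. *)
Definition saddle_part m := ray_coef a b m ('X^b * cutoff u v).

Lemma map_cutoff : map_poly (@conjc R) (cutoff u v) = cutoff v u.
Proof.
rewrite /cutoff rmorph_blend !rmorphM /= !map_polyXsubC !map_polyC /=.
have inv_sub (x y : R[i]) : ((x - y)^-1)^*%C = (x^*%C - y^*%C)^-1.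
  by rewrite conjc_inv rmorphB.
by rewrite !inv_sub conjcK.
Qed.

Lemma ray_coefJ m p :
  ray_coef a b m (map_poly (@conjc R) p) = (ray_coef a b m p)^*%C.
Proof.
have kernelJ : map_poly (@conjc R) (kernel_poly R[i] a b) = kernel_poly R[i] a b.
  rewrite /kernel_poly rmorphM !rmorphXn /= rmorphB rmorphD /= rmorph1.
  by rewrite map_polyX.
by rewrite /ray_coef -(coef_map (@conjc R)) rmorphM rmorphXn /= kernelJ.
Qed.

Lemma saddle_partJ m :
  ray_coef a b m ('X^b * cutoff v u) = (saddle_part m)^*%C.
Proof. by rewrite -ray_coefJ rmorphM /= map_polyXn map_cutoff. Qed.

Lemma saddle_part_sum m :
  (kernel_poly R[i] a b ^+ m)`_(b * m) = saddle_part m + (saddle_part m)^*%C.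
Proof.
rewrite -saddle_partJ -ray_coefD -mulrDr (cutoffD neq_uv) mulr1.
by rewrite /ray_coef coefXnM mulnS ltnNge leq_addr /= addKn.
Qed.

(** Division by Q after interpolation: multiples of the two cutoffs match the values of p at u and
    v. The size bound lets the reduction be repeated in one space. *)
Lemma saddle_split (p : {poly R[i]}) (d : nat) : (size p <= d)%N ->
  (size ('X^b * cutoff u v)%R <= d)%N -> (size ('X^b * cutoff v u)%R <= d)%N ->
  exists x y q, (size (ibp b q) <= d)%N /\
    p = x%:P * ('X^b * cutoff u v) + y%:P * ('X^b * cutoff v u)
        + saddle_poly R[i] a b * q.
Proof.
move=> sp su sv.
have u0 : u != 0 by exact: (saddle_neq0 a_gt0 b_gt0 saddleE).
have v0 : v != 0 by rewrite conjc_eq0.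
have [e eE] := cutoff_factor u v; have [e' e'E] := cutoff_factor v u.
have D := cutoffD neq_uv.
move: (cutoff u v) (cutoff v u) eE e'E D su sv => f g eE e'E D su sv.
have euv : f.[v] = 0 by rewrite eE !horner_simp subrr expr0n /= mul0r.
have evu : g.[u] = 0 by rewrite e'E !horner_simp subrr expr0n /= mul0r.
have euu : f.[u] = 1 by have := congr1 (horner^~ u) D; rewrite !horner_simp evu addr0.
have evv : g.[v] = 1 by have := congr1 (horner^~ v) D; rewrite !horner_simp euv add0r.
pose x := p.[u] / u ^+ b; pose y := p.[v] / v ^+ b.
pose t := p - x%:P * ('X^b * f) - y%:P * ('X^b * g).
have st : (size t <= d)%N.
  rewrite /t !mul_polyC (leq_trans (size_polyD _ _)) // geq_max size_polyN.
  rewrite (leq_trans (size_polyD _ _)) // ?geq_max ?size_polyN ?sp /=;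
    exact: leq_trans (size_scale_leq _ _) _.
have tu : root t u.
  by rewrite /root /t !horner_simp euu evu /x; apply/eqP; field; rewrite expf_neq0.
have tv : root t v.
  by rewrite /root /t !horner_simp euv evv /y; apply/eqP; field; rewrite expf_neq0.
have [t1 t1E] := factor_theorem _ _ tu.
have t1v : root t1 v.
  move: tv; rewrite t1E rootM root_XsubC eq_sym (negbTE neq_uv) orbF => //.
have [t2 t2E] := factor_theorem _ _ t1v.
have a_neq0 : a%:R != 0 :> R[i] by rewrite pnatr_eq0 -lt0n.
exists x, y, ((a%:R^-1)%:P * t2); split; last first.
  have aP : a%:R * (a%:R^-1)%:P = 1 :> {poly R[i]} by rewrite -polyC_natr -polyCM divff.
  transitivity (x%:P * ('X^b * f) + y%:P * ('X^b * g) + t).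
    by rewrite /t; ring.
  congr (_ + _); rewrite t1E t2E saddleE.
  transitivity (a%:R * (a%:R^-1)%:P * (t2 * ('X - v%:P) * ('X - u%:P))); last by ring.
  by rewrite aP mul1r.
have [->|t20] := eqVneq t2 0.
  by rewrite mulr0 /ibp !mulr0 deriv0 mulr0 subr0 size_poly0.
apply: size_ibp.
rewrite mul_polyC (@leq_trans (size t2 + 2)) ?leq_add2r ?size_scale_leq //.
move: st; rewrite t1E t2E size_Mmonic ?monicXsubC ?mulf_neq0 ?polyXsubC_eq0 //.
rewrite size_Mmonic ?monicXsubC // !size_XsubC.
by move: (size t2) => k; lia.
Qed.

Lemma ray_coef_le_sum m (p : {poly R[i]}) (d : nat) : (size p <= d)%N ->
  norm1 (ray_coef a b m p)
    <= (\sum_(k < d) norm1 p`_k) * \sum_(k < d) norm1 (ray_coef a b m 'X^k).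
Proof.
move=> sp; have pE : p = \sum_(k < d) (p`_k)%:P * 'X^k.
  rewrite -[LHS](take_poly_id sp) /take_poly poly_def; apply: eq_bigr => k _.
  by rewrite mul_polyC.
rewrite {1}pE ray_coef_sum; apply: le_trans (norm1_sum _ _) _.
rewrite mulr_suml; apply: ler_sum => k _; rewrite ray_coefCM.
apply: le_trans (norm1M _ _) _; apply: ler_wpM2l; first exact: norm1_ge0.
by rewrite (bigD1 k) //= lerDl sumr_ge0 // => j _; exact: norm1_ge0.
Qed.

Lemma norm1_ray_saddle m q :
  m%:R * norm1 (ray_coef a b m (saddle_poly R[i] a b * q))
  = norm1 (ray_coef a b m (ibp b q)).
Proof.
by rewrite -ray_coef_ibp -[in RHS](rmorph_nat (real_complex R)) norm1_real normr_nat.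
Qed.

(** Let N be the sum of the norms of the functionals on the monomials of degree below d. One
    reduction gives N <= A |Z_m| + (B/m) N; for m >= 2B the last term is absorbed, leaving N <= 2A
    |Z_m|. *)
Lemma ray_coef_bound (s : {poly R[i]}) : exists (K : R) (M : nat), forall m,
  (M <= m)%N -> norm1 (ray_coef a b m s) <= K * norm1 (saddle_part m).
Proof.
pose d := (size s + (size ('X^b * cutoff u v)%R + size ('X^b * cutoff v u)%R))%N.
have /fin_all_exists[f fP] : forall k : 'I_d, exists t : R[i] * R[i] * {poly R[i]},
    (size (ibp b t.2) <= d)%N /\ 'X^k = t.1.1%:P * ('X^b * cutoff u v)
      + t.1.2%:P * ('X^b * cutoff v u) + saddle_poly R[i] a b * t.2.
  move=> k; have [||| x [y [q h]]] := @saddle_split 'X^k d.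
  - by rewrite size_polyXn.
  - by rewrite /d addnCA leq_addr.
  - by rewrite /d addnA leq_addl.
  by exists (x, y, q).
pose A := \sum_(k < d) (norm1 (f k).1.1 + norm1 (f k).1.2).
pose B := \sum_(k < d) \sum_(j < d) norm1 (ibp b (f k).2)`_j.
pose N (m : nat) : R := \sum_(k < d) norm1 (ray_coef a b m ('X^k : {poly R[i]})).
have B0 : 0 <= B by apply: sumr_ge0 => k _; apply: sumr_ge0 => j _; exact: norm1_ge0.
have N0 m : 0 <= N m by apply: sumr_ge0 => k _; exact: norm1_ge0.
have key m : (0 < m)%N -> m%:R * N m <= m%:R * (A * norm1 (saddle_part m)) + B * N m.
  move=> m0; rewrite /A /B !mulr_suml /N !mulr_sumr -big_split /=.
  apply: ler_sum => k _; have [sk {1}->] := fP k.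
  rewrite !ray_coefD !ray_coefCM saddle_partJ -/(saddle_part m).
  apply: (@le_trans _ _ (m%:R * (norm1 (f k).1.1 * norm1 (saddle_part m)
    + norm1 (f k).1.2 * norm1 (saddle_part m)
    + norm1 (ray_coef a b m (saddle_poly R[i] a b * (f k).2))))).
    apply: ler_wpM2l; first exact: ler0n.
    apply: le_trans (norm1D _ _) (lerD _ (lexx _)).
    apply: le_trans (norm1D _ _) (lerD (norm1M _ _) _).
    by rewrite -(norm1_conj (saddle_part m)); exact: norm1M.
  rewrite mulrDr norm1_ray_saddle -mulrDl lerD2l.
  exact: ray_coef_le_sum.
exists ((\sum_(k < d) norm1 s`_k) * (2 * A)), (Num.bound (2 * B)).+1 => m mM.
have m0 : (0 < m)%N by apply: leq_trans mM.
apply: le_trans (@ray_coef_le_sum m s d (leq_addr _ _)) _.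
rewrite -mulrA; apply: ler_wpM2l; first by apply: sumr_ge0 => k _; exact: norm1_ge0.
rewrite -/(N m) -mulrA; have Bm : 2 * B <= m%:R.
  apply: le_trans (ltW (archi_boundP _)) _; first by rewrite mulr_ge0.
  by rewrite ler_nat ltnW.
have := key m m0; have := ler_wpM2r (N0 m) Bm.
have mR : 0 < m%:R :> R by rewrite ltr0n.
move: (N m) (A * _) => n z h1 h2.
rewrite -(ler_pM2l mR); lra.
Qed.

Hypothesis b_lt_a : (b < a)%N.

(** If Z_m = 0 for a large m, the bound annihilates the functionals of 1 and X, which are two
    neighbouring coefficients of a kernel; b < a keeps their indices in the range of
    [kernel_poly_consecutive]. *)
Lemma saddle_part_neq0 : exists M : nat, forall m, (M <= m)%N -> saddle_part m != 0.
Proof.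
have [K1 [M1 h1]] := ray_coef_bound 1; have [K2 [M2 h2]] := ray_coef_bound 'X.
exists (maxn 1 (maxn M1 M2)) => m.
rewrite !geq_max => /and3P[m0 m1 m2]; apply/eqP => z0.
have zero x (K : R) : norm1 x <= K * norm1 (saddle_part m) -> x = 0.
  rewrite z0 /norm1 normr0 addr0 mulr0 => h; apply/eqP.
  by rewrite -norm1_eq0 eq_le norm1_ge0 andbT; exact: h.
have := zero _ _ (h1 m m1); have := zero _ _ (h2 m m2).
rewrite /ray_coef mul1r coefXM kernel_polyX.
have -> : (b * m.+1 = (b * m.+1).-1.+1)%N by rewrite prednK // muln_gt0 b_gt0.
rewrite /=; apply: kernel_poly_consecutive.
have : (b * m < a * m)%N by rewrite ltn_pmul2r.
have : (b <= b * m)%N by rewrite leq_pmulr.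
by rewrite mulnS; move: (a * m)%N (b * m)%N => x y; lia.
Qed.
End Contraction.

Lemma sqrtr_ge1 (R : rcfType) (x : R) : 1 <= x -> 1 <= Num.sqrt x.
Proof. by move=> x1; rewrite -[leLHS]sqrtr1 ler_wsqrtr. Qed.

(** * Arguments of complex numbers and the arctangent *)

Section Angles.
Variable R : realType.
Implicit Types x y t : R.

Lemma atan_sub_le_pos t : 0 < t -> `|atan t - t| <= t ^+ 3.
Proof.
move=> t0.
have atan_cont : {within `[0, t], continuous (@atan R)}%classic.
  by apply: continuous_subspaceT => x; exact: continuous_atan.
have [c] := MVT t0 (fun x _ => is_derive1_atan x) atan_cont.
rewrite in_itv /= atan0 !subr0 => /andP[c0 ct] ->.
have c2 : 0 < 1 + c ^+ 2 by rewrite ltr_pwDl // sqr_ge0.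
have -> : (1 + c ^+ 2)^-1 * t - t = - (t * c ^+ 2 / (1 + c ^+ 2)).
  by field; rewrite gt_eqF.
rewrite normrN ger0_norm; last by rewrite divr_ge0 ?mulr_ge0 ?sqr_ge0 ?ltW.
rewrite ler_pdivrMr //; have cc : c ^+ 2 <= t ^+ 2 by rewrite lerXn2r ?nnegrE ?ltW.
have := sqr_ge0 c; have := sqr_ge0 t; have := ler_wpM2l (ltW t0) cc.
rewrite [t ^+ 3]exprS; move: (c ^+ 2) (t ^+ 2) => p q h q0 p0.
have : 0 <= t * q * p by rewrite !mulr_ge0 // ltW.
by lra.
Qed.

Lemma atan_sub_le t : `|atan t - t| <= `|t| ^+ 3.
Proof.
have [t0|t0|->] := ltgtP t 0; last by rewrite atan0 subr0 normr0 expr0n.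
  have t0' : 0 < - t by rewrite oppr_gt0.
  rewrite (ltr0_norm t0) -normrN opprB addrC -atanN -[X in _ + X]opprK.
  exact: atan_sub_le_pos.
by rewrite (gtr0_norm t0); exact: atan_sub_le_pos.
Qed.

Definition cis t : R[i] := (cos t +i* sin t)%C.

Lemma cisD x y : cis (x + y) = cis x * cis y.
Proof.
rewrite /cis cosD sinD; apply/eqP; rewrite eq_complex /= eqxx /=.
by apply/eqP; ring.
Qed.

Lemma cis0 : cis 0 = 1.
Proof. by rewrite /cis cos0 sin0. Qed.

Lemma polar_right x y : 0 < x -> exists2 r : R, 0 < r &
  (x +i* y)%C = r%:C%C * cis (atan (y / x)).
Proof.
move=> x0; set t := atan _; have c0 : 0 < cos t.
  by apply: cos_gt0_pihalf; rewrite atan_gtNpi2 atan_ltpi2.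
exists (x / cos t); first by rewrite divr_gt0.
have : tan t = y / x by rewrite /t atanK.
have c_neq0 : cos t != 0 by rewrite gt_eqF.
rewrite /tan => h; apply/eqP; rewrite eq_complex /= !mul0r subr0 addr0 divfK // eqxx /=.
by rewrite -mulrA [_^-1 * _]mulrC h; apply/eqP; field; rewrite gt_eqF.
Qed.

Lemma polar (z : R[i]) : z != 0 -> exists r t : R, 0 < r /\ z = r%:C%C * cis t.
Proof.
case: z => x y z0.
have [x0|x0|x0] := ltgtP x 0.
- have [|r r0 h] := @polar_right (- x) (- y); first by rewrite oppr_gt0.
  exists r, (atan (- y / - x) + pi); split => //.
  + by rewrite cisD mulrA -h /cis cospi sinpi; apply/eqP;
      rewrite eq_complex /= !mulr0 !mulrN1 !opprK subr0 add0r !eqxx.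
- by have [r r0 h] := polar_right y x0; exists r, (atan (y / x)).
- have [y0|y0|y0] := ltgtP y 0.
  + exists (- y), (- (pi / 2)); rewrite oppr_gt0; split => //.
    by rewrite /cis cosN sinN cos_pihalf sin_pihalf x0; apply/eqP;
      rewrite eq_complex /= !mulr0 !mul0r subr0 addr0 mulrN1 opprK !eqxx.
  + exists y, (pi / 2); split => //.
    by rewrite /cis cos_pihalf sin_pihalf x0; apply/eqP;
      rewrite eq_complex /= !mulr0 !mul0r subr0 addr0 mulr1 !eqxx.
  + by move: z0; rewrite x0 y0 eqxx.
Qed.

Lemma sin_mulrn0 t n : sin t = 0 -> sin (t *+ n) = 0.
Proof.
move=> s0; elim: n => [|n IHn]; first by rewrite mulr0n sin0.
by rewrite mulrS sinD s0 IHn mul0r mulr0 addr0.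
Qed.
End Angles.

(** Used with h = 1/m and x, y the real and imaginary parts of the normalised ratio of consecutive
    Z_m. The three terms of the constant bound atan t - t, t - y and y - k h^2, where t = y/x. *)
Lemma atan_ratio_asymp (R : realType) (x y k c h : R) :
  0 < h -> h <= 1 -> 0 <= c -> c * h <= 1 / 2 ->
  `|x - 1| <= c * h -> `|y - k * h ^+ 2| <= c * h ^+ 3 ->
  0 < x /\ `|atan (y / x) - k * h ^+ 2|
    <= ((2 * (`|k| + c)) ^+ 3 + 2 * (`|k| + c) * c + c) * h ^+ 3.
Proof.
move=> h0 h1 c0 ch hx hy.
have x12 : 1 / 2 <= x by move: hx; rewrite ler_norml => /andP[]; lra.
have x0 : 0 < x by lra.
split=> //; set t := y / x; set D := `|k| + c.
have D0 : 0 <= D by rewrite addr_ge0.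
have h2 : 0 <= h ^+ 2 by exact: sqr_ge0.
have h32 : h ^+ 3 <= h ^+ 2 by rewrite exprS ler_piMl.
have yD : `|y| <= D * h ^+ 2.
  have : `|y| <= `|y - k * h ^+ 2| + `|k * h ^+ 2|.
    by rewrite -{1}(subrK (k * h ^+ 2) y) ler_normD.
  rewrite normrM (ger0_norm h2); have := ler_wpM2l c0 h32.
  by rewrite /D mulrDl; lra.
have tx : t * x = y by rewrite /t divfK // gt_eqF.
clearbody t; have txn : `|t| * x = `|y| by rewrite -tx normrM (gtr0_norm x0).
have tD : `|t| <= 2 * D * h ^+ 2.
  have : `|t| * (1 / 2) <= `|t| * x by rewrite ler_wpM2l.
  by lra.
have ty : `|t - y| <= 2 * D * c * h ^+ 3.
  have -> : t - y = - (t * (x - 1)) by rewrite mulrBr mulr1 tx opprB.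
  rewrite normrN normrM; apply: le_trans (ler_pM _ _ tD hx) _ => //.
  by rewrite le_eqVlt; apply/orP; left; apply/eqP; ring.
have at3 : `|atan t - t| <= (2 * D) ^+ 3 * h ^+ 3.
  apply: le_trans (atan_sub_le t) _.
  have : `|t| <= 2 * D * h.
    apply: le_trans tD _; apply: ler_wpM2l; first by rewrite mulr_ge0.
    by rewrite expr2 ler_piMr // ltW.
  by move=> tDh; rewrite -exprMn; apply: lerXn2r => //; rewrite nnegrE ?mulr_ge0 // ltW.
have := ler_normD (atan t - t) (t - y).
have := ler_normD (atan t - t + (t - y)) (y - k * h ^+ 2).
have -> : atan t - t + (t - y) + (y - k * h ^+ 2) = atan t - k * h ^+ 2 by ring.
by rewrite !mulrDl; lra.
Qed.

Lemma rmorph_second_coef (F G : fieldType) (f : {rmorphism F -> G}) a x :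
  f (second_coef a x) = second_coef a (f x).
Proof.
by rewrite /second_coef rmorphB !fmorph_div; congr (_ / _ - _ / _); ring.
Qed.

Lemma norm1_div_le (R : realType) (s z : R[i]) (K : R) :
  z != 0 -> norm1 s <= K * norm1 z -> norm1 (s / z) <= 2 * K.
Proof.
case: z => x y z0 h.
have n0 : 0 < x ^+ 2 + y ^+ 2.
  rewrite lt_neqAle addr_ge0 ?sqr_ge0 // andbT eq_sym paddr_eq0 ?sqr_ge0 //.
  by rewrite !sqrf_eq0; move: z0; rewrite eq_complex.
have invE : (x +i* y)%C^-1 = ((x ^+ 2 + y ^+ 2)^-1)%:C%C * (x -i* y)%C.
  apply: (mulfI z0); rewrite divff //; apply/eqP; rewrite eq_complex /=.
  by apply/andP; split; apply/eqP; field; rewrite gt_eqF.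
rewrite invE; apply: le_trans (norm1M _ _) _; rewrite norm1_real.
rewrite gtr0_norm ?invr_gt0 // mulrCA mulrC ler_pdivrMr //.
have := normr_ge0 x; have := normr_ge0 y; move: h; rewrite /norm1 /= normrN.
rewrite -(real_normK (num_real x)) -(real_normK (num_real y)).
have : 0 <= `|complex.Re s| + `|complex.Im s| by rewrite addr_ge0.
have : 0 < `|x| + `|y|.
  rewrite lt_neqAle addr_ge0 // andbT eq_sym paddr_eq0 // !normr_eq0.
  by move: z0; rewrite eq_complex.
move: (`|x|) (`|y|) (`|_| + `|complex.Im s|) => p q S pq0 S0 h q0 p0.
have K0 : 0 <= K by rewrite -(pmulr_lge0 K pq0); exact: le_trans S0 h.
have := mulr_ge0 K0 (sqr_ge0 (p - q)); have := ler_wpM2l (ltW pq0) h.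
by lra.
Qed.

(** * Phases *)

Section Ray.
Variables (R : realType) (a b : nat) (u : R[i]).
Hypothesis b_gt0 : (0 < b)%N.
Hypothesis b_lt_a : (b < a)%N.
Local Notation v := (u^*%C).
Hypothesis neq_uv : u != v.
Hypothesis saddleE : saddle_poly R[i] a b = a%:R * (('X - u%:P) * ('X - v%:P)).

Let a_gt0 : (0 < a)%N. Proof. exact: leq_trans b_lt_a. Qed.
Local Notation Z := (@saddle_part R a b u).

(** The conjugate of K is the same expression at v, so [second_coef_sub] applies; there a <> b, and
    a^2 - ab + b^2 = (a-b)^2 + ab is positive. *)
Lemma Im_second_coef : complex.Im (second_coef a u) != 0.
Proof.
have conjE : (second_coef a u)^*%C = second_coef a v by exact: rmorph_second_coef.
apply/eqP => Im0; have := second_coef_sub a_gt0 b_gt0 neq_uv saddleE.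
rewrite -conjE; case: (second_coef a u) Im0 => x y /= ->.
have -> : (x +i* 0)%C - (x +i* 0)^*%C = 0 :> R[i] by rewrite /= oppr0 subrr.
move/esym/eqP; apply/negP.
have N1 : a%:R - b%:R != 0 :> R[i] by rewrite subr_eq0 eqr_nat gtn_eqF.
have N2 : a%:R ^+ 2 - a%:R * b%:R + b%:R ^+ 2 != 0 :> R[i].
  have -> : a%:R ^+ 2 - a%:R * b%:R + b%:R ^+ 2 = ((a - b) ^ 2 + a * b)%:R :> R[i].
    by rewrite natrD natrX natrB ?natrM ?(ltnW b_lt_a) //; ring.
  by rewrite pnatr_eq0 addn_eq0 muln_eq0 (gtn_eqF b_gt0) (gtn_eqF a_gt0) andbF.
have uv0 : u - v != 0 by rewrite subr_eq0.
have a0 : a%:R != 0 :> R[i] by rewrite pnatr_eq0 gtn_eqF.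
have b0 : b%:R != 0 :> R[i] by rewrite pnatr_eq0 gtn_eqF.
by rewrite mulf_neq0 // ?invr_eq0 ?mulf_neq0 ?expf_neq0.
Qed.

Lemma saddle_value_neq0 : (kernel_poly R[i] a b).[u] / u ^+ b != 0.
Proof.
have u0 := saddle_neq0 a_gt0 b_gt0 saddleE.
have u1 := saddle_neq1 a_gt0 saddleE; have uN1 := saddle_neqN1 a_gt0 b_gt0 saddleE.
rewrite mulf_neq0 ?invr_eq0 ?expf_neq0 //.
by rewrite /kernel_poly !horner_simp mulf_neq0 ?expf_neq0.
Qed.

(** [eps m] is the argument of the normalised ratio, obtained as an arctangent because the real part
    tends to 1. *)
Lemma saddle_part_step : exists (k c : R) (M : nat) (eps : nat -> R), [/\ k != 0,
  (forall m, (M <= m)%N -> saddle_part a b u m != 0 /\ exists2 r : R, 0 < r &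
     Z m.+1 / ((kernel_poly R[i] a b).[u] / u ^+ b * Z m) = r%:C%C * cis (eps m)) &
  forall m, (M <= m)%N -> `|eps m - k * m%:R^-1 ^+ 2| <= c * m%:R^-1 ^+ 3].
Proof.
set w := _ / u ^+ b; have w0 : w != 0 := saddle_value_neq0.
have [s sE] := saddle_expansion a_gt0 b_gt0 neq_uv saddleE.
have [M1 Z0] := saddle_part_neq0 a_gt0 b_gt0 neq_uv saddleE b_lt_a.
have [K [M2 sK]] := ray_coef_bound a_gt0 b_gt0 neq_uv saddleE s.
pose S m := ray_coef a b m s / (w * Z m).
have Sbound m : (M1 <= m)%N -> (M2 <= m)%N -> norm1 (S m) <= norm1 w^-1 * (2 * K).
  move=> m1 m2; rewrite /S invfM mulrCA; apply: le_trans (norm1M _ _) _.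
  by apply: ler_wpM2l; rewrite ?norm1_ge0 // norm1_div_le ?Z0 ?sK.
pose k2 := second_coef a u; pose C := norm1 w^-1 * (2 * K).
pose c := 1 / 2 + norm1 k2 + `|C|.
pose x m := complex.Re (Z m.+1 / (w * Z m)).
pose y m := complex.Im (Z m.+1 / (w * Z m)).
have ratioE m : (0 < m)%N -> (M1 <= m)%N -> Z m.+1 / (w * Z m)
  = 1 + ((- (1 / 2) * m%:R^-1 : R)%:C%C + ((m%:R^-1 ^+ 2 : R)%:C%C * k2
       + (m%:R^-1 ^+ 3 : R)%:C%C * S m)).
  move=> m0 m1; rewrite /saddle_part sE // -/w -/(saddle_part a b u m).
  have mC : m%:R != 0 :> R[i] by rewrite pnatr_eq0 -lt0n.
  rewrite !rmorphXn rmorphM rmorphN fmorph_div !fmorphV !rmorph_nat rmorph1 /S /k2 /=.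
  by field; rewrite mC w0 Z0.
have key m : (maxn 1 (maxn M1 M2) <= m)%N ->
    `|x m - 1| <= c * m%:R^-1
    /\ `|y m - complex.Im k2 * m%:R^-1 ^+ 2| <= c * m%:R^-1 ^+ 3.
  rewrite !geq_max => /and3P[m0 m1 m2]; rewrite /x /y ratioE //.
  have := Sbound m m1 m2; rewrite -/C; move: (S m) => [s1 s2]; rewrite /norm1 /= => Sb.
  have mR : 1 <= m%:R :> R by rewrite ler1n.
  have h0 : 0 < m%:R^-1 :> R by rewrite invr_gt0 (lt_le_trans _ mR).
  have h1 : m%:R^-1 <= 1 :> R by rewrite invf_le1 // (lt_le_trans _ mR).
  move: (m%:R^-1) h0 h1 => h h0 h1.
  have h2 : 0 <= h ^+ 2 by exact: sqr_ge0.
  have h21 : h ^+ 2 <= h by rewrite expr2 ler_piMl // ltW.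
  have h3 : 0 <= h ^+ 3 by rewrite exprn_ge0 // ltW.
  have h31 : h ^+ 3 <= h ^+ 2 by rewrite exprS ler_piMl.
  have := ler_norm C; rewrite /c /norm1; move: `|C| Sb => C' Sb CC'.
  case: (k2) => [k21 k22] /=; rewrite !mul0r !subr0 !addr0 !add0r.
  have s1C : `|s1| <= C' by have := normr_ge0 s2; lra.
  have s2C : `|s2| <= C' by have := normr_ge0 s1; lra.
  have C0 : 0 <= C' by apply: le_trans s1C.
  have s1h : `|h ^+ 3 * s1| <= h * C'.
    rewrite normrM (ger0_norm h3) ler_pM //; lra.
  have s2h : `|h ^+ 3 * s2| <= h ^+ 3 * C' by rewrite normrM (ger0_norm h3) ler_wpM2l.
  have k1h : `|h ^+ 2 * k21| <= h * `|k21| by rewrite normrM (ger0_norm h2) ler_wpM2r.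
  split.
    have := ler_normD (- (1 / 2) * h) (h ^+ 2 * k21 + h ^+ 3 * s1).
    have := ler_normD (h ^+ 2 * k21) (h ^+ 3 * s1).
    have -> : `|- (1 / 2) * h| = 1 / 2 * h.
      by rewrite mulNr normrN ger0_norm // mulr_ge0 // ltW.
    have := mulr_ge0 (ltW h0) (normr_ge0 k22).
    rewrite [1 + _]addrC addrK; lra.
  rewrite [h ^+ 2 * k22]mulrC [k22 * _ + _]addrC addrK.
  have := mulr_ge0 h3 (normr_ge0 k22); have := mulr_ge0 h3 (normr_ge0 k21); lra.
have c0 : 0 <= c by rewrite /c !addr_ge0 ?norm1_ge0 // divr_ge0.
(* The second bound makes c/m at most 1/2, which keeps the real part at least 1/2. *)
pose M := maxn (maxn 1 (maxn M1 M2)) (Num.bound (2 * c)).+1.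
pose D := ((2 * (`|complex.Im k2| + c)) ^+ 3 + 2 * (`|complex.Im k2| + c) * c + c).
have main m : (M <= m)%N -> 0 < x m /\
    `|atan (y m / x m) - complex.Im k2 * m%:R^-1 ^+ 2| <= D * m%:R^-1 ^+ 3.
  rewrite geq_max => /andP[mM mc]; have [hx hy] := key m mM.
  have m0 : (0 < m)%N by apply: leq_trans mc.
  apply: (atan_ratio_asymp _ _ c0 _ hx hy).
  - by rewrite invr_gt0 ltr0n.
  - by rewrite invf_le1 ?ltr0n // ler1n.
  rewrite ler_pdivrMr ?ltr0n //.
  have := archi_boundP (mulr_ge0 (ler0n R 2) c0).
  have : (Num.bound (2 * c))%:R <= m%:R :> R by rewrite ler_nat ltnW.
  by lra.
exists (complex.Im k2), D, M, (fun m => atan (y m / x m)); split.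
- exact: Im_second_coef.
- move=> m mM; have [x0 _] := main m mM; split.
    by apply: Z0; move: mM; rewrite !geq_max => /andP[/andP[_ /andP[]]].
  have [r r0 rE] := polar_right (y m) x0; exists r => //.
  by rewrite -rE /x /y; case: (_ / _).
- by move=> m mM; have [] := main m mM.
Qed.

(** From m to m + d, Z turns by d times the argument of h(u) plus the corrections. At a zero of f, Z
    is purely imaginary and nonzero, so between two zeros the total turn is a multiple of pi. *)
Lemma ray_zero_angles : exists (t k c : R) (M : nat) (eps : nat -> R), [/\ k != 0,
  (forall m, (M <= m)%N -> `|eps m - k * m%:R^-1 ^+ 2| <= c * m%:R^-1 ^+ 3) &
  forall m d, (M <= m)%N -> (kernel_poly R[i] a b ^+ m)`_(b * m) = 0 ->
    (kernel_poly R[i] a b ^+ (m + d))`_(b * (m + d)) = 0 ->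
    sin (t *+ d + \sum_(m <= j < m + d) eps j) = 0].
Proof.
have [k [c [M [eps [k0 step bound]]]]] := saddle_part_step.
move: step; set w := _ / u ^+ b => step.
have [r [t [r0 wE]]] := polar saddle_value_neq0.
exists t, k, c, M, eps; split=> // m d mM.
have rot : exists2 q : R, 0 < q &
    Z (m + d)%N = q%:C%C * cis (t *+ d + \sum_(m <= j < m + d) eps j) * Z m.
  elim: d => [|d [q q0 IHd]].
    by exists 1 => //; rewrite addn0 mulr0n big_geq // addr0 cis0 !mul1r.
  have [Zd [p p0 pE]] := step (m + d)%N (leq_trans mM (leq_addr _ _)).
  exists (p * r * q); first by rewrite !mulr_gt0.
  have -> : Z (m + d.+1)%N = p%:C%C * cis (eps (m + d)%N) * (w * Z (m + d)%N).
    by rewrite -pE addnS divfK // mulf_neq0 // saddle_value_neq0.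
  rewrite IHd {1}/w wE addnS big_nat_recr ?leq_addr //= mulrSr.
  set S := \sum_(m <= j < m + d) eps j.
  rewrite (_ : t *+ d + t + (S + _) = eps (m + d)%N + (t + (t *+ d + S))); last by ring.
  by rewrite !cisD !rmorphM /=; ring.
have [Zm _] := step m mM.
have [q q0] := rot; rewrite !(saddle_part_sum a b neq_uv).
move: (t *+ d + _) => phi.
move: (Z m) (Z (m + d)%N) Zm => [z1 z2] z' Zm -> /eqP.
rewrite eq_complex /= => /andP[/eqP h1 _].
have z10 : z1 = 0 by lra.
rewrite z10 in Zm *.
have z20 : z2 != 0 by move: Zm; rewrite eq_complex /= eqxx.
move/eqP; rewrite eq_complex /= => /andP[/eqP h2 _].
have : q * z2 * sin phi = 0 by lra.
by move/eqP; rewrite !mulf_eq0 (gt_eqF q0) (negbTE z20) => /eqP.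
Qed.
End Ray.

(** * Counting zeros *)

(** Weighting two angle sums by each other's length cancels the constant angle theta; this is what
    remains of the corrections. *)
Lemma sum_nat_diff (V : zmodType) (f : nat -> V) (m1 m2 m3 m4 : nat) :
  (\sum_(m1 <= i < m2) f i) *+ (m4 - m3) - (\sum_(m3 <= j < m4) f j) *+ (m2 - m1)
  = \sum_(m1 <= i < m2) \sum_(m3 <= j < m4) (f i - f j).
Proof.
have inner i : \sum_(m3 <= j < m4) (f i - f j)
    = f i *+ (m4 - m3) - \sum_(m3 <= j < m4) f j.
  by rewrite big_split /= sumr_const_nat sumrN.
rewrite (eq_bigr _ (fun i _ => inner i)) big_split /= sumrN sumr_const_nat.
by rewrite sumrMnl.
Qed.

Lemma sqrS_le4 n : (0 < n)%N -> (n.+1 ^ 2 <= 4 * n ^ 2)%N.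
Proof. by move=> n0; nia. Qed.

Section Gaps.
Variable R : realType.
Implicit Types (t k c : R) (eps : nat -> R).

Lemma sum_nat_bounds (F : nat -> R) (g : R) (m n : nat) : (m < n)%N ->
  (forall i, (m <= i < n)%N -> 0 < F i <= g) ->
  0 < \sum_(m <= i < n) F i <= g *+ (n - m).
Proof.
move=> mn H; apply/andP; split.
  rewrite big_ltn // ltr_pwDl //.
    by have /H/andP[] : (m <= m < n)%N by rewrite leqnn.
  rewrite big_nat sumr_ge0 // => i /andP[mi ilt].
  by have /andP[/ltW] : 0 < F i <= g by rewrite H // ltnW.
rewrite -sumr_const_nat; apply: ler_sum_nat => i im.
by have /andP[] := H i im.
Qed.

(** The case k > 0 of the block argument: the differences eps_i - eps_j are all positive once m3 -
    m2 >= A, and they are few and small enough to add up to less than pi. *)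
Lemma angle_gap t k c eps (M : nat) : 0 < k ->
  (forall m, (M <= m)%N -> `|eps m - k * m%:R^-1 ^+ 2| <= c * m%:R^-1 ^+ 3) ->
  exists A n0 : nat, forall n m1 m2 m3 m4 : nat, (n0 <= n)%N ->
    (n ^ 2 <= m1)%N -> (m1 < m2)%N -> (m2 + A <= m3)%N -> (m3 < m4)%N ->
    (m4 < n.+1 ^ 2)%N ->
    sin (t *+ (m2 - m1) + \sum_(m1 <= j < m2) eps j) = 0 ->
    sin (t *+ (m4 - m3) + \sum_(m3 <= j < m4) eps j) = 0 -> False.
Proof.
(* Chosen so that 4|c| < k A: the main term then beats the cubic errors. *)
move=> k0 bound; pose A := (Num.bound (4 * `|c| / k)).+1.
exists A, (maxn 1 (maxn M (Num.bound (18 * (k + `|c|)))).+1) => n m1 m2 m3 m4.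
rewrite geq_max gtn_max => /andP[n1 /andP[nM nb]] n2 m12 m23 m34 m4n sin1 sin2.
pose d1 := (m2 - m1)%N; pose d2 := (m4 - m3)%N.
have Delta0 : sin (\sum_(m1 <= i < m2) \sum_(m3 <= j < m4) (eps i - eps j)) = 0.
  rewrite -sum_nat_diff.
  have -> : (\sum_(m1 <= j < m2) eps j) *+ (m4 - m3)
       - (\sum_(m3 <= j < m4) eps j) *+ (m2 - m1)
     = (t *+ (m2 - m1) + \sum_(m1 <= j < m2) eps j) *+ (m4 - m3)
       - (t *+ (m4 - m3) + \sum_(m3 <= j < m4) eps j) *+ (m2 - m1).
    by rewrite !mulrnDl -!mulrnA [((m4 - m3) * _)%N]mulnC; ring.
  by rewrite sinB !sin_mulrn0 // mul0r mulr0 subr0.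
have C0 := normr_ge0 c; have cC := ler_norm c.
have n1R : 1 <= n%:R :> R by rewrite ler1n.
have Hn : 0 < n%:R :> R by lra.
have bound' m : (n ^ 2 <= m)%N -> [/\ 0 < m%:R^-1 :> R, m%:R^-1 <= (n%:R ^+ 2)^-1 :> R &
    `|eps m - k * m%:R^-1 ^+ 2| <= `|c| * m%:R^-1 ^+ 3].
  move=> nm; have nm1 : (n <= m)%N by apply: leq_trans nm; rewrite leq_pmulr.
  have mR : 0 < m%:R :> R by rewrite ltr0n (leq_trans n1).
  split; first by rewrite invr_gt0.
    by rewrite lef_pV2 ?posrE ?exprn_gt0 // -natrX ler_nat.
  apply: le_trans (bound m _) _; first by apply: leq_trans nm1; exact: ltnW.
  by rewrite ler_wpM2r // exprn_ge0 // invr_ge0 ltW.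
have term i j : (m1 <= i < m2)%N -> (m3 <= j < m4)%N ->
    0 < eps i - eps j <= 2 * (k + `|c|) * (n%:R ^+ 2)^-1 ^+ 2.
  move=> /andP[i1 i2] /andP[j1 j2].
  have ni : (n ^ 2 <= i)%N by apply: leq_trans i1.
  have nj : (n ^ 2 <= j)%N.
    apply: leq_trans ni (leq_trans (ltnW i2) (leq_trans _ j1)).
    exact: leq_trans (leq_addr _ _) m23.
  have [hi hin ei] := bound' i ni; have [hj hjn ej] := bound' j nj.
  have ij : (i + A <= j)%N.
    by apply: leq_trans j1; apply: leq_trans m23; rewrite leq_add2r ltnW.
  have j4i : (j <= 4 * i)%N.
    apply: leq_trans (ltnW j2) (leq_trans (ltnW m4n) (leq_trans (sqrS_le4 n1) _)).
    by rewrite leq_mul2l.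
  have iR : 0 < i%:R :> R by rewrite -invr_gt0.
  have jR : 0 < j%:R :> R by rewrite -invr_gt0.
  have hij : i%:R^-1 <= 4 * j%:R^-1 :> R.
    by rewrite ler_pdivlMr // mulrC ler_pdivrMr // -natrM ler_nat.
  have gap : i%:R^-1 - j%:R^-1 >= A%:R * (i%:R^-1 * j%:R^-1) :> R.
    have -> : i%:R^-1 - j%:R^-1 = (j%:R - i%:R) * (i%:R^-1 * j%:R^-1) :> R.
      by field; rewrite !gt_eqF.
    apply: ler_wpM2r; first by rewrite mulr_ge0 // ltW.
    by rewrite lerBrDr -natrD ler_nat addnC.
  have AR : 4 * `|c| < k * A%:R.
    rewrite [k * _]mulrC -ltr_pdivrMr //; apply: lt_le_trans (archi_boundP _) _.
      by rewrite divr_ge0 ?mulr_ge0 // ltW.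
    by rewrite ler_nat leqnSn.
  have B0 := ler0n R A.
  move: (i%:R^-1) (j%:R^-1) (A%:R) B0 hi hj hin hjn hij gap AR ei ej.
  move=> p q B Bge0 hi hj hin hjn hij gap AR.
  rewrite !ler_norml => /andP[ei1 ei2] /andP[ej1 ej2].
  have q0 := ltW hj; have p2 : 0 <= p ^+ 2 := sqr_ge0 p.
  set H := (n%:R ^+ 2)^-1 in hin hjn *.
  have H0 : 0 <= H by apply: le_trans hin; exact: ltW.
  have H1 : H <= 1 by rewrite invf_le1 ?exprn_gt0 // exprn_ege1.
  have qp : q <= p.
    by rewrite -subr_ge0; apply: le_trans gap; rewrite !mulr_ge0 // ltW.
  (* Here p = 1/i and q = 1/j. The main term is at least k B p q (p+q), the errors are at most |c|
     p^2 (p+q), and p <= 4q inside a block. *)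
  apply/andP; split.
    have gap2 : B * (p * q) * (p + q) <= (p - q) * (p + q).
      by rewrite ler_wpM2r // addr_ge0 // ltW.
    have gap3 : k * (B * (p * q) * (p + q)) <= k * ((p - q) * (p + q)).
      by rewrite ler_wpM2l // ltW.
    have cub : `|c| * (p ^+ 3 + q ^+ 3) <= `|c| * (p ^+ 2 * (p + q)).
      rewrite ler_wpM2l // !exprS expr0 !mulr1 mulrDr; rewrite lerD // ?mulrA //.
      by rewrite !ler_pM // ?mulr_ge0 // ltW.
    have strict : `|c| * (p ^+ 2 * (p + q)) < k * (B * (p * q) * (p + q)).
      have pq : 0 < p * (p + q) by rewrite mulr_gt0 // ltr_pwDl.
      have : 4 * `|c| * p < k * B * (4 * q).
        apply: lt_le_trans (_ : k * B * p <= _); first by rewrite ltr_pM2r.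
        by rewrite ler_wpM2l // mulr_ge0 // ltW.
      rewrite -(ltr_pM2r pq) => h.
      by rewrite -(@ltr_pM2l _ 4) //; move: h; rewrite -!mulrA; lra.
    have -> : 0 < eps i - eps j; last by [].
    by move: ei1 ej2; lra.
  have pH : p ^+ 2 <= H ^+ 2 by rewrite lerXn2r // nnegrE // ltW.
  have qH : q ^+ 2 <= H ^+ 2 by rewrite lerXn2r // nnegrE.
  have p3 : p ^+ 3 <= H ^+ 2.
    rewrite exprS; apply: le_trans (ler_wpM2l (ltW hi) pH) _.
    by rewrite ler_piMl ?sqr_ge0 // (le_trans hin).
  have q3 : q ^+ 3 <= H ^+ 2.
    rewrite exprS; apply: le_trans (ler_wpM2l q0 qH) _.
    by rewrite ler_piMl ?sqr_ge0 // (le_trans hjn).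
  have := ler_wpM2l (ltW k0) pH; have := ler_wpM2l C0 p3; have := ler_wpM2l C0 q3.
  have := mulr_ge0 (ltW k0) (sqr_ge0 q); have := mulr_ge0 (ltW k0) (sqr_ge0 H).
  by move: ei2 ej1; lra.
have /andP[Delta_gt0 Delta_le] := sum_nat_bounds m12 (fun i im =>
  sum_nat_bounds m34 (fun j jm => term i j im jm)).
have width p q : (n ^ 2 <= p)%N -> (q < n.+1 ^ 2)%N -> (q - p <= 3 * n)%N.
  by move=> np qn; rewrite leq_subLR; move: np qn n1; clear; nia.
have w1 : (m2 - m1 <= 3 * n)%N.
  apply: width => //; apply: leq_ltn_trans m4n.
  exact: leq_trans (leq_addr _ _) (leq_trans m23 (ltnW m34)).
have w2 : (m4 - m3 <= 3 * n)%N.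
  apply: width => //; apply: leq_trans n2 (leq_trans (ltnW m12) _).
  exact: leq_trans (leq_addr _ _) m23.
suff Delta_lt : \sum_(m1 <= i < m2) \sum_(m3 <= j < m4) (eps i - eps j) < pi.
  by have := sin_gt0_pi (introT andP (conj Delta_gt0 Delta_lt)); rewrite Delta0 ltxx.
(* There are at most 9 n^2 terms, each at most 2(k + |c|)/n^4, and pi >= 2. *)
apply: le_lt_trans Delta_le (lt_le_trans _ (pi_ge2 R)).
set g := 2 * (k + `|c|) * _; rewrite -mulrnA -(mulr_natr g).
have w12 : ((m4 - m3) * (m2 - m1))%:R <= 9 * n%:R ^+ 2 :> R.
  by rewrite -natrX -natrM ler_nat; have := leq_mul w2 w1; nia.
have kc0 : 0 <= k + `|c| by rewrite addr_ge0 // ltW.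
apply: le_lt_trans (ler_wpM2l _ w12) _; first by rewrite !mulr_ge0 // sqr_ge0.
rewrite /g.
have -> : 2 * (k + `|c|) * (n%:R ^+ 2)^-1 ^+ 2 * (9 * n%:R ^+ 2)
    = 18 * (k + `|c|) / n%:R ^+ 2.
  by field; rewrite gt_eqF.
have nbR : 18 * (k + `|c|) < n%:R.
  apply: lt_le_trans (archi_boundP _) _; first by rewrite mulr_ge0.
  by rewrite ler_nat ltnW.
rewrite ltr_pdivrMr ?exprn_gt0 //; apply: lt_le_trans nbR _.
have : 1 * n%:R <= n%:R * n%:R :> R by rewrite ler_wpM2r // ltW.
by rewrite expr2; lra.
Qed.
End Gaps.

(** Convolution of the two binomial expansions, with ['C(l2, l2 - j)] = ['C(l2, j)]. *)
Lemma coef_kernel_poly (R : comNzRingType) (l1 l2 : nat) :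
  (kernel_poly R l1 l2)`_l2 = (Cm11 l1 l2)%:~R.
Proof.
have coefB1 n i : ((1 - 'X : {poly R}) ^+ n)`_i = (-1) ^+ i * 'C(n, i)%:R.
  rewrite exprBn coef_sum; under eq_bigr do rewrite expr1n mulr1 coefMn -polyC1 -polyCN
    -rmorphXn mulrC /= coefMC coefXn.
  have [ni|ni] := ltnP i n.+1.
    rewrite (bigD1 (Ordinal ni)) //= eqxx mul1r big1 ?addr0 ?mulr_natr // => j ji.
    rewrite (negbTE (_ : i != j)) ?mul0r ?mul0rn //.
    by apply: contraNneq ji => ij; apply/eqP/val_inj.
  rewrite bin_small // mulr0 big1 // => j _.
  by rewrite gtn_eqF ?mul0r ?mul0rn // (leq_trans _ ni).
have coefD1 n i : ((1 + 'X : {poly R}) ^+ n)`_i = 'C(n, i)%:R.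
  rewrite exprDn coef_sum; under eq_bigr do rewrite expr1n mul1r coefMn coefXn.
  have [ni|ni] := ltnP i n.+1.
    rewrite (bigD1 (Ordinal ni)) //= eqxx big1 ?addr0 // => j ji.
    rewrite (negbTE (_ : i != j)) ?mul0rn //.
    by apply: contraNneq ji => ij; apply/eqP/val_inj.
  rewrite bin_small // big1 // => j _.
  by rewrite gtn_eqF ?mul0rn // (leq_trans _ ni).
rewrite /kernel_poly coefM /Cm11 rmorph_sum /=; apply: eq_bigr => j _.
by rewrite coefB1 coefD1 bin_sub -1?ltnS // !rmorphM rmorphXn rmorphN1 /= !pmulrn.
Qed.

Lemma coef_kernel_poly_eq0 (R : numDomainType) (l1 l2 : nat) :
  ((kernel_poly R l1 l2)`_l2 == 0) = (Cm11 l1 l2 == 0).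
Proof. by rewrite coef_kernel_poly intr_eq0. Qed.

Lemma sorted_ltn_nth_add (s : seq nat) i k : sorted ltn s -> (i + k < size s)%N ->
  (nth 0 s i + k <= nth 0 s (i + k))%N.
Proof.
move=> ss; elim: k => [|k IHk] h; first by rewrite !addn0.
rewrite !addnS in h *; apply: leq_ltn_trans (IHk (ltnW h)) _.
by rewrite (sorted_ltn_nth ltn_trans) // inE ltnW.
Qed.

(** If a block with n >= n0 held more than A + 4 elements of P, those of index 0, 1, 1 + A and 2 + A
    would contradict the hypothesis; each earlier block has at most n0^2 elements in all. *)
Lemma square_blocks_count (P : pred nat) (A n0 : nat) :
    (forall n m1 m2 m3 m4 : nat, (n0 <= n)%N ->
       (n ^ 2 <= m1)%N -> (m1 < m2)%N -> (m2 + A <= m3)%N -> (m3 < m4)%N ->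
    (m4 < n.+1 ^ 2)%N ->
       P m1 -> P m2 -> P m3 -> P m4 -> False) ->
  exists B, forall n, (count P (iota 0 (n ^ 2)) <= B * n)%N.
Proof.
move=> gap; exists (maxn (A + 4) (n0 ^ 2)); elim=> [|n IHn] //.
have n2 : (n ^ 2 <= n.+1 ^ 2)%N by rewrite leq_sqr.
rewrite -{1}(subnKC n2) iotaD count_cat add0n mulnS addnC leq_add //.
have [n0n|nn0] := leqP n0 n; last first.
  rewrite leq_max; apply/orP; right; apply: leq_trans (count_size _ _) _.
  by rewrite size_iota; apply: leq_trans (leq_subr _ _) _; rewrite leq_sqr.
rewrite leq_max -size_filter; set s := [seq m <- _ | P m]; apply/orP; left.
rewrite leqNgt; apply/negP => sA.
have ss : sorted ltn s by apply: (sorted_filter ltn_trans); exact: iota_ltn_sorted.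
have smem i : (i < size s)%N ->
    [/\ P (nth 0 s i), n ^ 2 <= nth 0 s i & nth 0 s i < n.+1 ^ 2]%N.
  move=> /(mem_nth 0); rewrite mem_filter mem_iota subnKC // => /and3P[Pi i1 i2].
  by split.
have [i0 i1 i2] : [/\ 0 + 1 < size s, 1 + A < size s & 1 + A + 1 < size s]%N.
  by move: (size s) sA; clear=> *; split; lia.
have h0 := sorted_ltn_nth_add ss i0; have h1 := sorted_ltn_nth_add ss i1.
have h2 := sorted_ltn_nth_add ss i2.
have [P1 l1 _] := smem 0%N (leq_ltn_trans (leq0n _) i0).
have [P2 _ _] := smem _ i0; have [P3 _ _] := smem _ i1; have [P4 _ u4] := smem _ i2.
apply: (gap n _ _ _ _ n0n l1 _ _ _ u4 P1 P2 P3 P4).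
- by move: h0; rewrite addn1.
- exact: h1.
- by move: h2; rewrite addn1.
Qed.

(** Negating all angles reduces k < 0 to k > 0. *)
Lemma square_angle_gap (R : realType) (t k c : R) (eps : nat -> R) (M : nat) : k != 0 ->
  (forall m, (M <= m)%N -> `|eps m - k * m%:R^-1 ^+ 2| <= c * m%:R^-1 ^+ 3) ->
  exists A n0 : nat, forall n m1 m2 m3 m4 : nat, (n0 <= n)%N ->
    (n ^ 2 <= m1)%N -> (m1 < m2)%N -> (m2 + A <= m3)%N -> (m3 < m4)%N ->
    (m4 < n.+1 ^ 2)%N ->
    sin (t *+ (m2 - m1) + \sum_(m1 <= j < m2) eps j) = 0 ->
    sin (t *+ (m4 - m3) + \sum_(m3 <= j < m4) eps j) = 0 -> False.
Proof.
move=> k0 bound; have [k_lt0|k_gt0|/eqP] := ltgtP k 0; last by rewrite (negbTE k0).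
  have [||A [n0 gap]] := @angle_gap R (- t) (- k) c (fun m => - eps m) M _.
  - by rewrite oppr_gt0.
  - by move=> m /bound; rewrite mulNr -opprD normrN.
  exists A, n0 => n m1 m2 m3 m4 h1 h2 h3 h4 h5 h6 s1 s2.
  by apply: (gap n m1 m2 m3 m4) => //; rewrite sumrN mulNrn -opprD sinN ?s1 ?s2 oppr0.
exact: angle_gap k_gt0 bound.
Qed.

(** (a - b)^2 - 4ab is the discriminant of Q: the last hypothesis makes it negative, so that the
    roots are conjugate, and [D] is its opposite. *)
Lemma ray_zeros_count (R : realType) (a b : nat) :
    (0 < b)%N -> (b < a)%N -> (a ^ 2 + b ^ 2 < 6 * a * b)%N ->
  exists B, forall n,
    (count (fun m => Cm11 (a * m) (b * m) == 0) (iota 0 (n ^ 2)) <= B * n)%N.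
Proof.
move=> b0 ba disc; have a0 : (0 < a)%N by apply: leq_trans ba.
pose D : R := (6 * a * b)%:R - (a ^ 2 + b ^ 2)%:R.
have D0 : 0 < D by rewrite subr_gt0 ltr_nat.
pose s := Num.sqrt D; have s0 : 0 < s by rewrite sqrtr_gt0.
have s2 : s ^+ 2 = D by rewrite sqr_sqrtr // ltW.
pose u : R[i] := ((b%:R - a%:R) / (2 * a%:R) +i* (s / (2 * a%:R)))%C.
have aR : a%:R != 0 :> R by rewrite pnatr_eq0 gtn_eqF.
have aR0 : 0 < a%:R :> R by rewrite ltr0n.
have neq_uv : u != u^*%C.
  rewrite eq_complex /= eqxx /= -addr_eq0 -mulr2n mulrn_eq0 /= mulf_neq0 ?gt_eqF //.
  by rewrite invr_gt0 mulr_gt0.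
have sumE : u + u^*%C = ((b%:R - a%:R) / a%:R : R)%:C%C.
  by apply/eqP; rewrite eq_complex /= subrr eqxx andbT; apply/eqP; field.
have prodE : u * u^*%C = (b%:R / a%:R : R)%:C%C.
  apply/eqP; rewrite eq_complex /=; apply/andP; split; apply/eqP; last by ring.
  transitivity (((b%:R - a%:R) ^+ 2 + s ^+ 2) / (4 * a%:R ^+ 2)); first by field.
  by rewrite s2 /D natrD !natrX !natrM; field.
have saddleE : saddle_poly R[i] a b = a%:R * (('X - u%:P) * ('X - (u^*%C)%:P)).
  transitivity (a%:R * 'X ^+ 2 - a%:R * (u + u^*%C)%:P * 'X
    + a%:R * (u * u^*%C)%:P : {poly R[i]}).
    have scale (x : R) : a%:R * (((x / a%:R : R)%:C%C)%:P : {poly R[i]}) = (x%:C%C)%:P.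
      rewrite -polyC_natr -polyCM -(rmorph_nat (real_complex R)) -rmorphM /=.
      by rewrite mulrC divfK.
    rewrite sumE prodE !scale !(rmorphB, rmorph_nat) /= /saddle_poly; ring.
  by rewrite polyCD polyCM; ring.
have [t [k [c [M [eps [k0 bound angle]]]]]] := ray_zero_angles b0 ba neq_uv saddleE.
have [A [n0 gap]] := square_angle_gap t k0 bound.
apply: (@square_blocks_count _ A (maxn n0 M)) => n m1 m2 m3 m4.
rewrite geq_max => /andP[n0n Mn] l1 m12 m23 m34 u4 z1 z2 z3 z4.
have zero m : Cm11 (a * m) (b * m) == 0 -> (kernel_poly R[i] a b ^+ m)`_(b * m) = 0.
  by move=> z; apply/eqP; rewrite kernel_polyX coef_kernel_poly_eq0.
have Mm1 : (M <= m1)%N.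
  by apply: leq_trans Mn (leq_trans _ l1); case: (n) => // j; rewrite leq_pmulr.
have Mm3 : (M <= m3)%N.
  apply: leq_trans Mm1 (leq_trans (ltnW m12) _); exact: leq_trans (leq_addr _ _) m23.
apply: (gap n m1 m2 m3 m4) => //.
- have := angle m1 (m2 - m1)%N Mm1; rewrite subnKC ?(ltnW m12) //.
  by apply; exact: zero.
- have := angle m3 (m4 - m3)%N Mm3; rewrite subnKC ?(ltnW m34) //.
  by apply; exact: zero.
Qed.

Local Open Scope classical_set_scope.
Local Open Scope ring_scope.

(** * The range r > 3 + 2 sqrt 2 *)

(** With c_k = (-1)^k p_k and s = (l1 - l2)/2, the recurrence reads (k+2) c_(k+2) = 2s c_(k+1) -
    (l1+l2-k) c_k. If (k+1) c_(k+1) >= s c_k, the right side is at least s c_(k+1) as soon as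
    (l1+l2-k)(k+1) <= s^2. *)
Lemma kernel_poly_alternating (R : realFieldType) (l1 l2 k : nat) :
    (0 < l2)%N -> (l2 < l1)%N -> 4 * l2%:R * (l1%:R + 1) <= (l1%:R - l2%:R) ^+ 2 :> R ->
  (k < l2)%N ->
  0 < (-1) ^+ k * (kernel_poly R l1 l2)`_k
  /\ (l1%:R - l2%:R) / 2 * ((-1) ^+ k * (kernel_poly R l1 l2)`_k)
       <= k.+1%:R * ((-1) ^+ k.+1 * (kernel_poly R l1 l2)`_k.+1).
Proof.
move=> l20 l12 disc.
set s := (l1%:R - l2%:R) / 2.
have s0 : 0 < s :> R by rewrite divr_gt0 // subr_gt0 ltr_nat.
have s2E : l1%:R - l2%:R = 2 * s by rewrite /s; field.
elim: k => [|k IHk] kl2.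
  rewrite kernel_poly_coef0 kernel_poly_coef1 expr0 expr1 !mul1r mulr1; split => //.
  by lra.
have [c0 c1] := IHk (ltnW kl2).
have /= := kernel_poly_rec R l1 l2 k.
move/(congr1 (fun x => (-1) ^+ k * x)); rewrite !exprS in c1 *.
move: (kernel_poly R l1 l2)`_k (kernel_poly R l1 l2)`_k.+1 c0 c1.
move: (kernel_poly R l1 l2)`_k.+2 ((-1) ^+ k) => p2 e p0 p1 c0 c1 rec.
have c1' : 0 < -1 * e * p1.
  by rewrite -(pmulr_rgt0 _ (ltr0Sn R k)); apply: lt_le_trans c1; rewrite mulr_gt0.
split=> //.
have -> : k.+2%:R * (-1 * (-1 * e) * p2)
    = 2 * s * (-1 * e * p1) - (l1%:R + l2%:R - k%:R) * (e * p0).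
  by rewrite -s2E; move: rec; lra.
move: (e * p0) (-1 * e * p1) c0 c1 c1' => x y x0 sx y0.
(* For k < l2 the left side is largest at k = l2 - 1, where it equals l2 (l1 + 1). *)
have jle : (l1%:R + l2%:R - k%:R) * k.+1%:R <= s ^+ 2.
  have kR : k%:R + 1 <= l2%:R :> R by rewrite natr1 ler_nat ltnW.
  have l12R : l2%:R <= l1%:R :> R by rewrite ler_nat ltnW.
  have : 0 <= (l2%:R - k%:R - 1) * (l1%:R - k%:R) :> R by rewrite mulr_ge0; lra.
  by rewrite -natr1; move: disc; rewrite s2E exprMn; lra.
have lk : 0 <= l1%:R + l2%:R - k%:R :> R.
  by rewrite subr_ge0 -natrD ler_nat; move: kl2; clear; lia.
have h1 := ler_wpM2l lk sx; have h2 := ler_wpM2r (ltW y0) jle.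
rewrite -(ler_pM2l s0); move: h1 h2; lra.
Qed.

Lemma Cm11_neq0 (R : realFieldType) (l1 l2 : nat) :
    (0 < l2)%N -> (l2 < l1)%N -> 4 * l2%:R * (l1%:R + 1) <= (l1%:R - l2%:R) ^+ 2 :> R ->
  Cm11 l1 l2 != 0.
Proof.
move=> l20 l12 disc; rewrite -(coef_kernel_poly_eq0 R).
have k1 : (l2.-1 < l2)%N by rewrite prednK.
have [c0 c1] := kernel_poly_alternating l20 l12 disc k1.
move: c1; rewrite prednK // => c1; apply/eqP => z; move: c1; rewrite z !mulr0.
by apply/negP; rewrite -ltNge mulr_gt0 // divr_gt0 // subr_gt0 ltr_nat.
Qed.

Lemma Ncount_le (R : realType) (r x : R) (T : eqType) (f : nat * nat -> T) (L : seq T) :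
    (forall l, zero_pairs r x l -> f l \in L) ->
    (forall l l', zero_pairs r x l -> zero_pairs r x l' -> f l = f l' -> l = l') ->
  (Ncount r x <= size L)%N.
Proof.
move=> fL finj; have fin := finite_zero_pairs r x.
have memE l : l \in fset_set (zero_pairs r x) -> zero_pairs r x l.
  by rewrite in_fset_set // => /set_mem.
rewrite /Ncount -(size_map f); apply: uniq_leq_size.
  rewrite map_inj_in_uniq ?fset_uniq // => l l' /memE zl /memE zl'; exact: finj.
by move=> _ /mapP[l /memE zl ->]; exact: fL.
Qed.

Lemma zero_pairs_snd_inj (R : realType) (r x : R) l l' :
  zero_pairs r x l -> zero_pairs r x l' -> l.2 = l'.2 -> l = l'.
Proof.
case: l l' => [l1 l2] [l1' l2'] [/= _ _ h _ _] [/= _ _ h' _ _] e; subst l2'.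
by congr (_, _); apply/eqP; rewrite -(eqr_nat R) h h'.
Qed.

Lemma Ncount_bounded (R : realType) (r : R) : 3 + 2 * Num.sqrt 2 < r ->
  exists K : R, \forall x \near +oo, (Ncount r x)%:R <= K.
Proof.
move=> hr; have sq2 : 0 <= Num.sqrt 2 :> R := sqrtr_ge0 2.
have sq22 : Num.sqrt 2 ^+ 2 = 2 :> R by rewrite sqr_sqrtr.
have Q0 : 0 < r ^+ 2 - 6 * r + 1 by move: hr sq2 sq22; set q := Num.sqrt 2; nra.
(* On the ray l1 = r l2 the hypothesis of [Cm11_neq0] reduces to 4 <= (r^2 - 6r + 1) l2. *)
pose M := Num.bound (4 / (r ^+ 2 - 6 * r + 1)).
exists M%:R; near=> x; rewrite ler_nat -(size_iota 0 M).
apply: (@Ncount_le _ _ _ _ snd) => [l|]; last exact: zero_pairs_snd_inj.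
case: l => l1 l2 h; rewrite mem_iota add0n leq0n ltnNge; apply/negP => /= Ml.
case: h => /= l10 l20 rl z _.
have l2R : 1 <= l2%:R :> R by rewrite ler1n.
have MR : 4 < (r ^+ 2 - 6 * r + 1) * l2%:R.
  rewrite mulrC -ltr_pdivrMr //; apply: lt_le_trans (archi_boundP _) _.
    by rewrite divr_ge0 // ltW.
  by rewrite ler_nat.
have l12 : (l2 < l1)%N.
  rewrite -(ltr_nat R) rl -[ltLHS]mul1r ltr_pM2r; lra.
move/eqP: z; apply/negP; apply: (@Cm11_neq0 R) => //; rewrite rl.
have : 0 <= ((r ^+ 2 - 6 * r + 1) * l2%:R - 4) * l2%:R by rewrite mulr_ge0; lra.
by move: l2%:R => y; lra.
Unshelve. all: by end_near.
Qed.

(** * The range 1 < r < 3 + 2 sqrt 2 *)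

(** One point of the ray divided by its gcd gives the primitive point (a, b); by Gauss's lemma every
    other point is a multiple of it. *)
Lemma ray_generator (R : realType) (r : R) (l1 l2 : nat) :
    (0 < l1)%N -> (0 < l2)%N -> l1%:R = r * l2%:R ->
  exists a b : nat, [/\ (0 < a)%N, (0 < b)%N, a%:R = r * b%:R &
    forall m1 m2 : nat, m1%:R = r * m2%:R ->
      m1 = (a * (m2 %/ b))%N /\ m2 = (b * (m2 %/ b))%N].
Proof.
move=> l10 l20 rl; pose g := gcdn l1 l2; have g0 : (0 < g)%N by rewrite gcdn_gt0 l10.
pose a := (l1 %/ g)%N; pose b := (l2 %/ g)%N.
have aE : l1 = (a * g)%N by rewrite divnK // dvdn_gcdl.
have bE : l2 = (b * g)%N by rewrite divnK // dvdn_gcdr.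
have a0 : (0 < a)%N by move: l10; rewrite aE muln_gt0 => /andP[].
have b0 : (0 < b)%N by move: l20; rewrite bE muln_gt0 => /andP[].
have gR : g%:R != 0 :> R by rewrite pnatr_eq0 gtn_eqF.
have ab : a%:R = r * b%:R :> R by apply: (mulIf gR); rewrite -mulrA -!natrM -aE -bE.
have cop : coprime b a.
  by rewrite /coprime gcdnC -(eqn_pmul2r g0) muln_gcdl -aE -bE mul1n.
exists a, b; split=> // m1 m2 m12.
have cross : (m1 * b = a * m2)%N.
  by apply/eqP; rewrite -(eqr_nat R) !natrM m12 ab; apply/eqP; ring.
have bm : (b %| m2)%N by rewrite -(Gauss_dvdr _ cop) -cross dvdn_mull.
have m2E : m2 = (b * (m2 %/ b))%N by rewrite mulnC divnK.
split=> //; apply/eqP; rewrite -(eqn_pmul2r b0) cross {1}m2E.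
by rewrite -mulnA [(b * _)%N]mulnC.
Qed.

Lemma Ncount_sqrt (R : realType) (r : R) : 1 < r -> r < 3 + 2 * Num.sqrt 2 ->
  exists2 K : R, 0 <= K & forall x, 1 <= x -> (Ncount r x)%:R <= K * Num.sqrt x.
Proof.
move=> r1 r3; have [[[l1 l2] /= [l10 l20 rl]]|none] := pselect (exists l : nat * nat,
    [/\ (0 < l.1)%N, (0 < l.2)%N & l.1%:R = r * l.2%:R]); last first.
  exists 0 => // x x1; suff /eqP -> : Ncount r x == 0%N by rewrite mul0r.
  rewrite -leqn0.
  apply: (@Ncount_le R r x _ snd [::]) => l.
    by case=> h1 h2 h3 _ _; case: none; exists l.
  by move=> l'; exact: zero_pairs_snd_inj.
have [a [b [a0 b0 ab gen]]] := ray_generator l10 l20 rl.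
have bR : 0 < b%:R :> R by rewrite ltr0n.
have ba : (b < a)%N by rewrite -(ltr_nat R) ab -[ltLHS]mul1r ltr_pM2r.
have disc : (a ^ 2 + b ^ 2 < 6 * a * b)%N.
  have sq2 : 0 <= Num.sqrt 2 :> R := sqrtr_ge0 2.
  have sq22 : Num.sqrt 2 ^+ 2 = 2 :> R by rewrite sqr_sqrtr.
  have Q0 : 0 < - r ^+ 2 + 6 * r - 1.
    have : 1 <= Num.sqrt 2 :> R by rewrite sqrtr_ge1 // ler1n.
    move: r1 r3 sq2 sq22; set q := Num.sqrt 2 => *.
    (* The roots of r^2 - 6r + 1 are 3 + 2q and 3 - 2q, and the latter is at most 1 < r. *)
    have : 0 < (3 + 2 * q - r) * (r - 3 + 2 * q) by rewrite mulr_gt0; lra.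
    by lra.
  rewrite -(ltr_nat R) natrD !natrX !natrM ab -subr_gt0.
  have -> : 6 * (r * b%:R) * b%:R - ((r * b%:R) ^+ 2 + b%:R ^+ 2)
    = (- r ^+ 2 + 6 * r - 1) * b%:R ^+ 2 by ring.
  by rewrite mulr_gt0 // exprn_gt0.
have [B count_le] := ray_zeros_count R b0 ba disc.
exists (2 * B%:R); first by rewrite mulr_ge0.
move=> x x1; have x0 : 0 <= x by apply: le_trans x1.
have s1 := sqrtr_ge1 x1.
have /andP[t1 t2] := truncn_itv (sqrtr_ge0 x).
(* All m with bm <= x lie below (n + 1)^2, so the first n + 1 blocks suffice. *)
set n := Num.truncn (Num.sqrt x) in t1 t2.
have xn : x < (n.+1 ^ 2)%:R.
  by rewrite natrX -(sqr_sqrtr x0) ltrXn2r // ?nnegrE ?sqrtr_ge0.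
pose L := [seq m <- iota 0 (n.+1 ^ 2) | Cm11 (a * m) (b * m) == 0].
have NL : (Ncount r x <= size L)%N.
  apply: (@Ncount_le R r x _ (fun l => l.2 %/ b)%N L) => [[m1 m2] h|].
    rewrite mem_filter mem_iota add0n leq0n; case: h => _ _ m12 z m2x.
    have [m1E m2E] := gen _ _ m12.
    rewrite -[(a * _)%N]m1E -[(b * _)%N]m2E [Cm11 _ _]z eqxx andTb.
    rewrite -(ltr_nat R); apply: le_lt_trans xn; apply: le_trans m2x.
    by rewrite ler_nat leq_div.
  move=> l l' zl zl' e; apply: (zero_pairs_snd_inj zl zl').
  case: zl zl' => _ _ h _ _ [_ _ h' _ _].
  by have [_ ->] := gen _ _ h; have [_ ->] := gen _ _ h'; rewrite e.
apply: (@le_trans _ _ (B%:R * n.+1%:R)).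
  by rewrite -natrM ler_nat (leq_trans NL) // size_filter.
rewrite [2 * _]mulrC -mulrA ler_wpM2l // -natr1; lra.
Qed.

Unset Implicit Arguments.

Theorem theorem7 (R : realType) (r : R) (hr : 1 < r) :
  (3 + 2 * Num.sqrt 2 < r ->
     exists K : R, \forall x \near +oo, (Ncount r x)%:R <= K) /\
  (r < 3 + 2 * Num.sqrt 2 ->
     exists K : R, \forall x \near +oo,
       (Ncount r x)%:R <=
         102644%:R / ((- r ^+ 2 + 6 * r - 1) `^ (11 / 4)
                      * ln ((1 + Num.sqrt 5) / 2))
           * Num.sqrt x * ln x
         + K * Num.sqrt x).
Proof.
split=> [|r3]; first exact: Ncount_bounded.
have [K K0 NK] := Ncount_sqrt hr r3; exists K; near=> x.
have x1 : 1 <= x by near: x; apply: nbhs_pinfty_ge; rewrite num_real.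
(* The golden ratio is at least 1, so the main term is nonnegative and the bound K sqrt x already
   suffices. *)
apply: le_trans (NK x x1) _; rewrite lerDr !mulr_ge0 ?sqrtr_ge0 ?ln_ge0 // invr_ge0.
rewrite mulr_ge0 ?powR_ge0 // ln_ge0 //.
have : 1 <= Num.sqrt 5 :> R by rewrite sqrtr_ge1 // ler1n.
by lra.
Unshelve. all: by end_near.
Qed.
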